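(* Let $H$ be a Hilbert space and let $Q\in\mathbb{B}(H)$ be a non-projection idempotent. Let $T_Q=m(Q)+m(Q)Q\in\mathbb{B}(H)$ and $$\widetilde{T_Q}=\begin{pmatrix}D+I_{H_5}&-\ell(D)\\0&0\end{pmatrix}\in\mathbb{B}(H_5\oplus H_5),$$ where $H_5$ and $D\in\mathbb{B}(H_5)$ come from the canonical decomposition of $Q$ described in the context and $\ell(D)=(D(D-I_{H_5}))^{1/2}$. Then $$\operatorname{int}\big(\overline{W(T_Q)}\big)\subseteq W\big(\widetilde{T_Q}\big)=W(T_Q).$$
   Context: $H$ is a non-zero complex Hilbert space and $\mathbb{B}(H)$ the bounded operators on it. An idempotent satisfies $Q^2=Q$; a projection is a self-adjoint idempotent; a non-projection idempotent is an idempotent that is not a projection. $\mathcal{R},\mathcal{N}$ denote range and null space, $P_M$ the orthogonal projection onto a closed subspace $M$, $|T|=(T^*T)^{1/2}$, $T^\dag$ the Moore-Penrose inverse. The numerical range of an operator $T$ on a Hilbert space is $W(T)=\{\langle Tx,x\rangle:\|x\|=1\}$; $\overline{E}$ and $\operatorname{int}(E)$ are the closure and interior of $E\subseteq\mathbb{C}$. Matched projection: $m(Q)=\frac12(|Q^*|+Q^* )|Q^*|^\dag(|Q^*|+I)^{-1}(|Q^*|+Q)$, which is a projection. Canonical decomposition of a non-projection idempotent $Q$: put $H_1=\mathcal{R}(m(Q))\cap\mathcal{R}(Q)$, $H_4=\mathcal{N}(m(Q))\cap\mathcal{N}(Q)$, $H_5=\overline{\mathcal{R}(m(Q)Q(I-m(Q)))}$,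 $H_6=\overline{\mathcal{R}((I-m(Q))Qm(Q))}$ (some of $H_1,H_4$ may be zero). These are mutually orthogonal with $m(Q)=P_{H_1}+P_{H_5}$ and $I-m(Q)=P_{H_4}+P_{H_6}$, and $U_{m(Q),Q}:H\to H_1\oplus H_4\oplus H_5\oplus H_6$, $x\mapsto(P_{H_1}x,P_{H_4}x,P_{H_5}x,P_{H_6}x)^T$, is unitary. It is known that there are a unitary $U\in\mathbb{B}(H_5,H_6)$ and an operator $D\in\mathbb{B}(H_5)$ with $D\ge I_{H_5}$ and $\mathcal{N}(D-I_{H_5})=\{0\}$ such that, with $\ell(D)=(D(D-I_{H_5}))^{1/2}$, $$U_{m(Q),Q}\,Q\,U_{m(Q),Q}^*=I_{H_1}\oplus 0_{H_4}\oplus\begin{pmatrix}D&-\ell(D)U^*\\ U\ell(D)&U(I_{H_5}-D)U^*\end{pmatrix}.$$ Set $V_Q=(I_{H_1}\oplus I_{H_4}\oplus I_{H_5}\oplus U^* )U_{m(Q),Q}$. Then $$m(Q)=V_Q^*\big(I_{H_1}\oplus0_{H_4}\oplus I_{H_5}\oplus0_{H_5}\big)V_Q,\qquad Q=V_Q^*\big(I_{H_1}\oplus0_{H_4}\oplus\widetilde{Q}\big)V_Q,\qquad \widetilde{Q}=\begin{pmatrix}D&-\ell(D)\\ \ell(D)&I_{H_5}-D\end{pmatrix}.$$ *)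

(* Defs.v *)
From HB Require Import structures.
From mathcomp Require Import all_boot all_order all_algebra.
From mathcomp Require Import ring complex.
From mathcomp Require Import all_classical all_reals topology normedtype.

Set Implicit Arguments.
Unset Strict Implicit.
Unset Printing Implicit Defensive.

Import Order.TTheory GRing.Theory Num.Theory.
Import numFieldNormedType.Exports.

Local Open Scope classical_set_scope.
Local Open Scope ring_scope.
Local Open Scope complex_scope.

Section Contractions.
Context {K : numFieldType} {V W : normedModType K} (f : V -> W)
  (fC : forall x y, `|f x - f y| <= `|x - y|).

Lemma contract_continuous : continuous f.
Proof.
move=> x; apply/cvgrPdist_lt => e e0; near=> y.
by apply: le_lt_trans (fC _ _) _; near: y; exact: cvgr_dist_lt.
Unshelve. all: by end_near. Qed.

Lemma contract_cauchy (F : set_system V) :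
  ProperFilter F -> cauchy F -> cauchy (f @ F).
Proof.
move=> FF /cauchyP Fc; apply/cauchyP => e e0.
have [x Fx] := Fc e e0; exists (f x).
suff H : ball x e `<=` f @^-1` ball (f x) e by exact: filterS H Fx.
by move=> y; rewrite /= -!ball_normE /=; exact: le_lt_trans.
Qed.

End Contractions.

(* The inner product is linear in its first argument. *)
HB.mixin Record isHilbert (R : realType) V & CompleteNormedModule R[i] V := {
  inner : {dot V for @Num.conj R[i]} ;
  normr_inner : forall x : V, `|x| ^+ 2 = inner x x
}.

#[short(type="hilbertType")]
HB.structure Definition Hilbert (R : realType) :=
  {V of CompleteNormedModule R[i] V & isHilbert R V}.

Definition linear_set (R : pzRingType) (V : lmodType R) (A : set V) :=
  A 0 /\ forall a x y, A x -> A y -> A (a *: x + y).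

Record csubspace (R : realType) (H : hilbertType R) := CSubspace {
  cs_set : set H ;
  cs_linear : linear_set cs_set ;
  cs_closed : closed cs_set }.

Section SubspaceType.
Context {R : realType} {H : hilbertType R}.

Definition cs_mem (M : csubspace H) : {pred H} := fun x => `[< cs_set M x >].

Lemma cs_mem_submod (M : csubspace H) : submod_closed (cs_mem M).
Proof.
have [M0 ML] := cs_linear M.
by split=> [|a x y /asboolP Mx /asboolP My]; apply/asboolP => //; exact: ML.
Qed.

HB.instance Definition _ (M : csubspace H) :=
  GRing.isSubmodClosed.Build R[i] H (cs_mem M) (cs_mem_submod M).

Record subsp (M : csubspace H) := SubSp {
  subsp_val : H ; _ : subsp_val \in cs_mem M }.

Context (M : csubspace H).

HB.instance Definition _ := [isSub for @subsp_val M].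
HB.instance Definition _ := [Choice of subsp M by <:].
HB.instance Definition _ := [SubChoice_isSubLmodule of subsp M by <:].

Definition subsp_norm (x : subsp M) : R[i] := `|val x|.

Let subsp_normD x y : subsp_norm (x + y) <= subsp_norm x + subsp_norm y.
Proof. by rewrite /subsp_norm raddfD ler_normD. Qed.

Let subsp_normZ l x : subsp_norm (l *: x) = `|l| * subsp_norm x.
Proof. by rewrite /subsp_norm linearZ normrZ. Qed.

Let subsp_norm0 x : subsp_norm x = 0 -> x = 0.
Proof. by move=> /normr0_eq0 x0; apply: val_inj; rewrite x0 raddf0. Qed.

HB.instance Definition _ :=
  Lmodule_isNormed.Build R[i] (subsp M) subsp_normD subsp_normZ subsp_norm0.

Lemma subsp_val_contract (x y : subsp M) : `|val x - val y| <= `|x - y|.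
Proof. by rewrite -raddfB. Qed.

Let subsp_complete (F : set_system (subsp M)) :
  ProperFilter F -> cauchy F -> cvg F.
Proof.
move=> FF Fc; have := contract_cauchy subsp_val_contract FF Fc.
move=> /cauchy_cvg /cvg_ex [l Fl].
have Ml : l \in cs_mem M.
  apply/asboolP; apply: (@closed_cvg _ _ F _ val (cs_set M)) Fl; first exact: cs_closed.
  by apply: nearW => -[x /= /asboolP].
apply/cvg_ex; exists (SubSp Ml); apply/cvgrPdist_lt => e e0.
by have /cvgrPdist_lt/(_ e e0) := Fl.
Qed.

HB.instance Definition _ := Uniform_isComplete.Build (subsp M) subsp_complete.

Definition subsp_inner (x y : subsp M) : R[i] := inner (val x) (val y).

Let subsp_inner_bilinear :
  bilinear_for (GRing.Scale.Law.clone _ _ *%R _)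
    (GRing.Scale.Law.clone _ _ (@Num.conj R[i] \; *%R) _) subsp_inner.
Proof.
have valP_ a (u v : subsp M) : val (a *: u + v) = a *: val u + val v.
  by rewrite linearP.
split=> [y|x] a u v; rewrite /subsp_inner valP_.
  exact: linearPl.
exact: linearPr.
Qed.

HB.instance Definition _ := bilinear_isBilinear.Build R[i] (subsp M) (subsp M)
  R[i] _ _ subsp_inner subsp_inner_bilinear.

Let subsp_inner_herm x y :
  subsp_inner x y = (-1) ^+ false * (subsp_inner y x)^*%R.
Proof. exact: hermitian_subproof. Qed.

HB.instance Definition _ := isHermitianSesquilinear.Build R[i] (subsp M) false
  (@Num.conj R[i]) subsp_inner subsp_inner_herm.

Let subsp_inner_gt0 (x : subsp M) : x != 0 -> 0 < subsp_inner x x.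
Proof. by move=> x0; apply: neq0_dnorm_gt0; rewrite -(inj_eq val_inj) in x0. Qed.

HB.instance Definition _ := isDotProduct.Build R[i] (subsp M) subsp_inner
  subsp_inner_gt0.

Let subsp_normr_inner (x : subsp M) : `|x| ^+ 2 = subsp_inner x x.
Proof. exact: normr_inner. Qed.

HB.instance Definition _ := isHilbert.Build R (subsp M) subsp_normr_inner.

End SubspaceType.

(* Orthogonal direct sum of two Hilbert spaces.  A separate type is needed
   since the library norm on H * K is the maximum of the norms. *)

Definition hsum (R : realType) (H K : hilbertType R) : Type := (H * K)%type.

Section DirectSum.
Context {R : realType} {H K : hilbertType R}.

HB.instance Definition _ := GRing.Lmodule.copy (hsum H K) (H * K)%type.

Definition hsum_norm (x : hsum H K) : R[i] :=
  sqrtC (`|x.1| ^+ 2 + `|x.2| ^+ 2).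

Let hsum_norm_ge0 x : 0 <= hsum_norm x.
Proof. by rewrite sqrtC_ge0 addr_ge0 ?exprn_ge0. Qed.

Let hsum_norm_sqr x : hsum_norm x ^+ 2 = `|x.1| ^+ 2 + `|x.2| ^+ 2.
Proof. exact: sqrtCK. Qed.

Let minkowski2 (a b c d p q : R[i]) :
  0 <= a -> 0 <= b -> 0 <= c -> 0 <= d -> 0 <= p -> 0 <= q ->
  p ^+ 2 = a ^+ 2 + b ^+ 2 -> q ^+ 2 = c ^+ 2 + d ^+ 2 ->
  (a + c) ^+ 2 + (b + d) ^+ 2 <= (p + q) ^+ 2.
Proof.
move=> a0 b0 c0 d0 p0 q0 pE qE.
have H1 : a * c + b * d <= p * q.
  rewrite -(@ler_pXn2r _ 2) ?nnegrE ?addr_ge0 ?mulr_ge0// exprMn pE qE.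
  have : 0 <= (a * d - b * c) ^+ 2.
    by rewrite real_exprn_even_ge0// rpredB// ger0_real// mulr_ge0.
  rewrite -subr_ge0 => /le_trans; apply; rewrite le_eqVlt; apply/orP; left.
  by apply/eqP; ring.
have -> : (a + c) ^+ 2 + (b + d) ^+ 2 =
    p ^+ 2 + q ^+ 2 + (a * c + b * d) *+ 2 by rewrite pE qE; ring.
have -> : (p + q) ^+ 2 = p ^+ 2 + q ^+ 2 + (p * q) *+ 2 by ring.
by rewrite lerD2l lerMn2r.
Qed.

Let hsum_normD x y : hsum_norm (x + y) <= hsum_norm x + hsum_norm y.
Proof.
rewrite -(@ler_pXn2r _ 2) ?nnegrE ?addr_ge0// hsum_norm_sqr.
apply: (@le_trans _ _ ((`|x.1| + `|y.1|) ^+ 2 + (`|x.2| + `|y.2|) ^+ 2)).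
  by apply: lerD; rewrite ler_pXn2r ?nnegrE ?addr_ge0// ler_normD.
exact: minkowski2.
Qed.

Let hsum_normZ l x : hsum_norm (l *: x) = `|l| * hsum_norm x.
Proof.
apply/eqP; rewrite -(@eqrXn2 _ 2)// ?mulr_ge0//.
by rewrite exprMn !hsum_norm_sqr /= !normrZ !exprMn mulrDr.
Qed.

Lemma hsum_fst_le (x : hsum H K) : `|x.1| <= hsum_norm x.
Proof.
by rewrite -(@ler_pXn2r _ 2) ?nnegrE// hsum_norm_sqr lerDl exprn_ge0.
Qed.

Lemma hsum_snd_le (x : hsum H K) : `|x.2| <= hsum_norm x.
Proof.
by rewrite -(@ler_pXn2r _ 2) ?nnegrE// hsum_norm_sqr lerDr exprn_ge0.
Qed.

Lemma hsum_norm_le (x : hsum H K) : hsum_norm x <= `|x.1| + `|x.2|.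
Proof.
rewrite -(@ler_pXn2r _ 2) ?nnegrE ?addr_ge0// hsum_norm_sqr sqrrD.
by rewrite lerD2r lerDl mulrn_wge0 ?mulr_ge0.
Qed.

Let hsum_norm0 x : hsum_norm x = 0 -> x = 0.
Proof.
move=> x0; have := hsum_fst_le x; have := hsum_snd_le x.
rewrite x0 !normr_le0 => /eqP x20 /eqP x10.
by rewrite [x]surjective_pairing x10 x20.
Qed.

HB.instance Definition _ :=
  Lmodule_isNormed.Build R[i] (hsum H K) hsum_normD hsum_normZ hsum_norm0.

Let hsum_complete (F : set_system (hsum H K)) :
  ProperFilter F -> cauchy F -> cvg F.
Proof.
move=> FF Fc.
have /cauchy_cvg /cvg_ex[l1 Fl1] :
    cauchy ((fun x : hsum H K => x.1) @ F).
  by apply: contract_cauchy Fc => x y; exact: (hsum_fst_le (x - y)).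
have /cauchy_cvg /cvg_ex[l2 Fl2] :
    cauchy ((fun x : hsum H K => x.2) @ F).
  by apply: contract_cauchy Fc => x y; exact: (hsum_snd_le (x - y)).
apply/cvg_ex; exists ((l1, l2) : hsum H K); apply/cvgrPdist_lt => e e0.
have e20 : 0 < e / 2 by rewrite divr_gt0.
have /cvgrPdist_lt/(_ _ e20) Fe1 := Fl1.
have /cvgrPdist_lt/(_ _ e20) Fe2 := Fl2.
near=> x; apply: le_lt_trans (hsum_norm_le _) _.
rewrite [e in _ < e]splitr; apply: ltrD; near: x.
  exact: Fe1.
exact: Fe2.
Unshelve. all: by end_near. Qed.

HB.instance Definition _ := Uniform_isComplete.Build (hsum H K) hsum_complete.

Definition hsum_inner (x y : hsum H K) : R[i] :=
  inner x.1 y.1 + inner x.2 y.2.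

Let hsum_inner_bilinear :
  bilinear_for (GRing.Scale.Law.clone _ _ *%R _)
    (GRing.Scale.Law.clone _ _ (@Num.conj R[i] \; *%R) _) hsum_inner.
Proof.
split=> [y|x] a u v; rewrite /hsum_inner.
  by rewrite linearPl linearPl /= mulrDr addrACA.
by rewrite linearPr linearPr /= mulrDr addrACA.
Qed.

HB.instance Definition _ := bilinear_isBilinear.Build R[i] (hsum H K) (hsum H K)
  R[i] _ _ hsum_inner hsum_inner_bilinear.

Let hsum_inner_herm x y :
  hsum_inner x y = (-1) ^+ false * (hsum_inner y x)^*%R.
Proof.
rewrite /hsum_inner mul1r rmorphD/=; congr (_ + _).
  by rewrite [LHS]hermitian_subproof mul1r.
by rewrite [LHS]hermitian_subproof mul1r.
Qed.

HB.instance Definition _ := isHermitianSesquilinear.Build R[i] (hsum H K) false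
  (@Num.conj R[i]) hsum_inner hsum_inner_herm.

Let hsum_normr_inner (x : hsum H K) : `|x| ^+ 2 = hsum_inner x x.
Proof. by rewrite [LHS]hsum_norm_sqr !normr_inner. Qed.

Let hsum_inner_gt0 (x : hsum H K) : x != 0 -> 0 < hsum_inner x x.
Proof. by move=> x0; rewrite -hsum_normr_inner exprn_gt0 ?normr_gt0. Qed.

HB.instance Definition _ := isDotProduct.Build R[i] (hsum H K) hsum_inner
  hsum_inner_gt0.

HB.instance Definition _ := isHilbert.Build R (hsum H K) hsum_normr_inner.

End DirectSum.

Definition bounded_linear (R : realType) (H K : hilbertType R) : {pred H -> K} :=
  fun f => `[< linear f /\ continuous f >].

Lemma bounded_linear_submod (R : realType) (H K : hilbertType R) :
  submod_closed (@bounded_linear R H K).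
Proof.
split=> [|a f g /asboolP[fL fC] /asboolP[gL gC]]; apply/asboolP; split.
- by move=> a x y; rewrite /= scaler0 addr0.
- exact: cst_continuous.
- move=> b x y; rewrite !fctE fL gL !scalerDr !scalerA mulrC -!addrA.
  by congr (_ + _); rewrite addrCA.
- by move=> x; apply: cvgD; [apply: cvgZr; exact: fC | exact: gC].
Qed.

HB.instance Definition _ (R : realType) (H K : hilbertType R) :=
  GRing.isSubmodClosed.Build R[i] (H -> K) (@bounded_linear R H K)
    (@bounded_linear_submod R H K).

Record bop (R : realType) (H K : hilbertType R) := Bop {
  bop_fun :> H -> K ; _ : bop_fun \in @bounded_linear R H K }.

Notation "''B' ( H , K )" := (bop H K)
  (at level 8, format "''B' ( H ,  K )") : type_scope.

Section BoundedOperators.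
Context {R : realType}.
Implicit Types H K L : hilbertType R.

HB.instance Definition _ H K := [isSub for @bop_fun R H K].
HB.instance Definition _ H K := [Choice of 'B(H, K) by <:].
HB.instance Definition _ H K := [SubChoice_isSubLmodule of 'B(H, K) by <:].

Lemma bop_linear H K (T : 'B(H, K)) : linear T.
Proof. by case: T => f /= /asboolP[]. Qed.

Lemma bop_continuous H K (T : 'B(H, K)) : continuous T.
Proof. by case: T => f /= /asboolP[]. Qed.

Arguments bop_continuous {H K} T.

HB.instance Definition _ H K (T : 'B(H, K)) :=
  GRing.isLinear.Build R[i] H K _ (bop_fun T) (bop_linear T).

Lemma bidP H : @idfun H \in @bounded_linear R H H.
Proof. by apply/asboolP; split=> // x; exact: cvg_id. Qed.

Definition bid H : 'B(H, H) := Bop (bidP H).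

Lemma bcompP H K L (S : 'B(K, L)) (T : 'B(H, K)) :
  S \o T \in @bounded_linear R H L.
Proof.
apply/asboolP; split=> [a x y|x]; first by rewrite /= !linearP.
by apply: continuous_comp; exact: bop_continuous.
Qed.

Definition bcomp H K L (S : 'B(K, L)) (T : 'B(H, K)) : 'B(H, L) :=
  Bop (bcompP S T).

Lemma bpairP H K L (S : 'B(H, K)) (T : 'B(H, L)) :
  (fun x => (S x, T x) : hsum K L) \in @bounded_linear R H (hsum K L).
Proof.
apply/asboolP; split=> [a x y|x]; first by rewrite !linearP.
apply/cvgrPdist_lt => e e0.
have e20 : 0 < e / 2 by rewrite divr_gt0.
have /cvgrPdist_lt/(_ _ e20) Se := bop_continuous S x.
have /cvgrPdist_lt/(_ _ e20) Te := bop_continuous T x.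
near=> y; apply: le_lt_trans (hsum_norm_le _) _.
rewrite [e in _ < e]splitr; apply: ltrD; near: y.
  exact: Se.
exact: Te.
Unshelve. all: by end_near. Qed.

Definition bpair H K L (S : 'B(H, K)) (T : 'B(H, L)) : 'B(H, hsum K L) :=
  Bop (bpairP S T).

Lemma bfstP H K : (fun x : hsum H K => x.1) \in @bounded_linear R (hsum H K) H.
Proof.
apply/asboolP; split=> //.
by apply: contract_continuous => x y; exact: (hsum_fst_le (x - y)).
Qed.

Definition bfst H K : 'B(hsum H K, H) := Bop (bfstP H K).

Lemma bsndP H K : (fun x : hsum H K => x.2) \in @bounded_linear R (hsum H K) K.
Proof.
apply/asboolP; split=> //.
by apply: contract_continuous => x y; exact: (hsum_snd_le (x - y)).
Qed.

Definition bsnd H K : 'B(hsum H K, K) := Bop (bsndP H K).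

End BoundedOperators.

Arguments bop_continuous {R H K} T.

Notation "S \oB T" := (bcomp S T) (at level 40, left associativity) : ring_scope.

Section OperatorTheory.
Context {R : realType}.
Implicit Types H K L : hilbertType R.

(* The operator matrix with rows (A, B) and (C, D). *)
Definition block_op H K H' K' (A : 'B(H, H')) (B : 'B(K, H'))
    (C : 'B(H, K')) (D : 'B(K, K')) : 'B(hsum H K, hsum H' K') :=
  bpair (A \oB bfst H K + B \oB bsnd H K) (C \oB bfst H K + D \oB bsnd H K).

Definition diag_op H K H' K' (S : 'B(H, H')) (T : 'B(K, K')) :
    'B(hsum H K, hsum H' K') := block_op S 0 0 T.

(* The operators selected by xget are unique when they exist, and 0 is a dummy
   value otherwise.  The adjoint and the orthogonal projection always exist, the
   positive square root exists for T >= 0, the inverse for T invertible, and the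
   Moore-Penrose inverse for T with closed range. *)

Definition adjB H K (T : 'B(H, K)) : 'B(K, H) :=
  xget 0 [set S : 'B(K, H) | forall x y, inner (T x) y = inner x (S y)].

Definition projB H (M : csubspace H) : 'B(H, subsp M) :=
  xget 0 [set P : 'B(H, subsp M) |
    forall x (z : subsp M), inner (x - val (P x)) (val z) = 0].

(* The order of R[i] is partial: 0 <= z means that z is real and nonnegative. *)
Definition positiveB H (T : 'B(H, H)) := forall x, 0 <= inner (T x) x.

Definition sqrtB H (T : 'B(H, H)) : 'B(H, H) :=
  xget 0 [set S : 'B(H, H) | positiveB S /\ S \oB S = T].

Definition absB H K (T : 'B(H, K)) : 'B(H, H) := sqrtB (adjB T \oB T).

Definition invB H K (T : 'B(H, K)) : 'B(K, H) :=
  xget 0 [set S : 'B(K, H) | S \oB T = bid H /\ T \oB S = bid K].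

Definition pinvB H K (T : 'B(H, K)) : 'B(K, H) :=
  xget 0 [set X : 'B(K, H) |
    [/\ T \oB X \oB T = T, X \oB T \oB X = X,
        adjB (T \oB X) = T \oB X & adjB (X \oB T) = X \oB T]].

Definition unitaryB H K (U : 'B(H, K)) :=
  adjB U \oB U = bid H /\ U \oB adjB U = bid K.

Definition idempotentB H (Q : 'B(H, H)) := Q \oB Q = Q.

Definition projectionB H (P : 'B(H, H)) := idempotentB P /\ adjB P = P.

Definition kerB H K (T : 'B(H, K)) : set H := [set x | T x = 0].

Definition numrange H (T : 'B(H, H)) : set R[i]^o :=
  [set inner (T x) x | x in [set x : H | `|x| = 1]].

Lemma linear_set_range H K (T : 'B(H, K)) : linear_set (range T).
Proof.
split; first by exists 0; rewrite ?linear0.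
move=> a _ _ [x _ <-] [y _ <-]; exists (a *: x + y) => //.
by rewrite linearP.
Qed.

Lemma linear_set_ker H K (T : 'B(H, K)) : linear_set (kerB T).
Proof.
split; first exact: linear0.
by move=> a x y Tx Ty; rewrite /kerB /= linearP /= Tx Ty scaler0 addr0.
Qed.

Lemma linear_setI H (A B : set H) :
  linear_set A -> linear_set B -> linear_set (A `&` B).
Proof.
move=> [A0 AL] [B0 BL]; split=> // a x y [Ax Bx] [Ay By].
by split; [exact: AL | exact: BL].
Qed.

Lemma linear_set_closure H (A : set H) :
  linear_set A -> linear_set (closure A).
Proof.
move=> [A0 AL]; split=> [|a x y Ax Ay B Bxy]; first exact: subset_closure.
have Fc : (fun z : H * H => a *: z.1 + z.2) @ (x, y) --> a *: x + y.
  by apply: cvgD; [apply: cvgZr; exact: cvg_fst | exact: cvg_snd].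
have [[U V] /= [Ux Vy] UVB] := Fc B Bxy.
have [x' [Ax' Ux']] := Ax U Ux; have [y' [Ay' Vy']] := Ay V Vy.
by exists (a *: x' + y'); split; [exact: AL | exact: (UVB (x', y'))].
Qed.

Lemma closed_ker H K (T : 'B(H, K)) : closed (kerB T).
Proof.
suff -> : kerB T = T @^-1` [set 0].
  have /continuous_closedP := bop_continuous T; apply.
  exact/accessible_closed_set1/hausdorff_accessible/norm_hausdorff.
by [].
Qed.

End OperatorTheory.

Arguments closed_ker {R H K} T.

Section MatchedProjection.
Context {R : realType} {H : hilbertType R}.

Definition closure_subspace (A : set H) (AL : linear_set A) : csubspace H :=
  CSubspace (linear_set_closure AL) (@closed_closure _ A).

Context (Q : 'B(H, H)).

Definition matched_proj : 'B(H, H) :=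
  let absQ' := absB (adjB Q) in
  2^-1 *: ((absQ' + adjB Q) \oB pinvB absQ' \oB invB (absQ' + bid H)
           \oB (absQ' + Q)).

Local Notation m := matched_proj.

(* range m and range Q are closed when Q is idempotent (m and Q are then both
   idempotent), so that taking the closure does not change Hsub1. *)
Definition Hsub1 : csubspace H :=
  closure_subspace (linear_setI (linear_set_range m) (linear_set_range Q)).

Definition Hsub4 : csubspace H :=
  CSubspace (linear_setI (linear_set_ker m) (linear_set_ker Q))
    (closedI (closed_ker m) (closed_ker Q)).

Definition Hsub5 : csubspace H :=
  closure_subspace (linear_set_range (m \oB Q \oB (bid H - m))).

Definition Hsub6 : csubspace H :=
  closure_subspace (linear_set_range ((bid H - m) \oB Q \oB m)).

Definition Hcan1 : hilbertType R := subsp Hsub1.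
Definition Hcan4 : hilbertType R := subsp Hsub4.
Definition Hcan5 : hilbertType R := subsp Hsub5.
Definition Hcan6 : hilbertType R := subsp Hsub6.

Definition U_mQ : 'B(H, hsum Hcan1 (hsum Hcan4 (hsum Hcan5 Hcan6))) :=
  bpair (projB Hsub1) (bpair (projB Hsub4) (bpair (projB Hsub5) (projB Hsub6))).

End MatchedProjection.

Definition ell (R : realType) (K : hilbertType R) (D : 'B(K, K)) : 'B(K, K) :=
  sqrtB (D \oB (D - bid K)).

Definition canonical_decomposition (R : realType) (H : hilbertType R)
    (Q : 'B(H, H)) (U : 'B(Hcan5 Q, Hcan6 Q)) (D : 'B(Hcan5 Q, Hcan5 Q)) :=
  let I5 := bid (Hcan5 Q) in
  [/\ unitaryB U, positiveB (D - I5), kerB (D - I5) = [set 0] &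
      U_mQ Q \oB Q \oB adjB (U_mQ Q) =
        diag_op (bid (Hcan1 Q)) (diag_op (0 : 'B(Hcan4 Q, Hcan4 Q))
          (block_op D (- (ell D \oB adjB U))
                    (U \oB ell D) (U \oB (I5 - D) \oB adjB U)))].

Definition T_op (R : realType) (H : hilbertType R) (Q : 'B(H, H)) : 'B(H, H) :=
  matched_proj Q + matched_proj Q \oB Q.

Definition T_tilde (R : realType) (K : hilbertType R) (D : 'B(K, K)) :
    'B(hsum K K, hsum K K) :=
  block_op (D + bid K) (- ell D) 0 0.

(* Main.v *)
(* Put m = m(Q).  Let S = |Q*| and G = S + Q*, so that G* G = 2 S (S + 1) and
   m = G (G* G)^+ G* is the orthogonal projection onto the range of G.  With
   J = 2m - 1 one finds Q J = S = J Q*; as S >= 0, this forces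
   R(m) /\ N(Q) = 0 and N(m) /\ R(Q) = 0, which yields the orthogonal
   decomposition of H into H1, H4, H5 and H6.  In these coordinates, writing
   T for T_tilde D,
     W(T_Q) = { 2 |a|^2 + <T y, y> : |a|^2 + |b|^2 + |y|^2 = 1 }.
   By the Toeplitz-Hausdorff theorem W(T) is convex; it contains 0 and also a
   real number <D c, c> + 1 >= 2 for every unit vector c of H5 (H5 <> 0 because Q
   is not a projection), hence 2.  Therefore W(T_Q) = W(T), and the inclusion
   int (cl C) <= C holds for every convex set C of the plane. *)
From HB Require Import structures.
Require Import Defs.
From mathcomp Require Import all_boot all_order all_algebra.
From mathcomp Require Import ring lra complex.
From mathcomp Require Import all_classical all_reals topology normedtype sequences.
Set Implicit Arguments.
Unset Strict Implicit.
Unset Printing Implicit Defensive.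
Import Order.TTheory GRing.Theory Num.Theory.
Import numFieldNormedType.Exports.
Local Open Scope classical_set_scope.
Local Open Scope ring_scope.

(** The operators inside [matched_proj] are selected by [xget], so nothing is known about them until
    an operator with the defining property is exhibited. The delicate ones are |Q*| and its
    Moore-Penrose inverse, because Q Q* need not be invertible. The range of Q is closed, however,
    and with P the orthogonal projection onto it, Q Q* + (1 - P) >= 1. A positive multiple of this
    operator is at norm distance less than 1 from the identity, so an iteration with geometric
    convergence gives a square root that commutes with P. Multiplying it by P yields |Q*|, and
    inverting |Q*| + (1 - P) yields the Moore-Penrose inverse. No spectral theory enters. *)

Local Notation Re := complex.Re.
Local Notation Im := complex.Im.

(** * Real-valued norm *)

Section RealNorm.
Context {R : realType} {H : hilbertType R}.
Implicit Types (x y z : H) (a : R[i]).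

(* The library norm has values in R[i]; hn is the same norm as a real number. *)
Definition hn x : R := Re `|x|.

Lemma hnE x : `|x| = (hn x)%:C%C.
Proof. by rewrite /hn RRe_real// normr_real. Qed.

Lemma hn_ge0 x : 0 <= hn x.
Proof. by rewrite -ler0c -hnE. Qed.

Lemma hn0 : hn (0 : H) = 0.
Proof. by rewrite /hn normr0. Qed.

Lemma hn_eq0 x : hn x = 0 -> x = 0.
Proof. by move=> x0; apply/normr0_eq0; rewrite hnE x0. Qed.

Lemma hnD x y : hn (x + y) <= hn x + hn y.
Proof. by rewrite -lecR rmorphD/= -!hnE ler_normD. Qed.

Lemma hnN x : hn (- x) = hn x.
Proof. by rewrite /hn normrN. Qed.

Lemma hnB x y : hn (x - y) <= hn x + hn y.
Proof. by rewrite -[hn y]hnN hnD. Qed.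

Lemma hnZ a x : hn (a *: x) = Re `|a| * hn x.
Proof.
apply: complexI; rewrite -hnE normrZ rmorphM/= -hnE.
by congr (_ * _); rewrite RRe_real// normr_real.
Qed.

Lemma hnZr (t : R) x : 0 <= t -> hn (t%:C%C *: x) = t * hn x.
Proof. by move=> t0; rewrite hnZ ger0_norm// ler0c. Qed.

Lemma hn_sqr x : inner x x = (hn x ^+ 2)%:C%C.
Proof. by rewrite -normr_inner hnE rmorphXn. Qed.

Lemma hn_sqr_Re x : hn x ^+ 2 = Re (inner x x).
Proof. by rewrite hn_sqr. Qed.

Lemma innerC x y : inner x y = (inner y x)^*.
Proof. by rewrite hermC mul1r. Qed.

Lemma innerDl x y z : inner (x + y) z = inner x z + inner y z.
Proof. exact: linearDl. Qed.

Lemma complex_Re_conj a : Re a^* = Re a. Proof. by case: a. Qed.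
Lemma complex_Im_conj a : Im a^* = - Im a. Proof. by case: a. Qed.

Lemma conj_real (t : R) : (t%:C%C)^* = t%:C%C.
Proof. by apply/eqP; rewrite eq_complex/= oppr0 !eqxx. Qed.

Lemma hn_sqrD x y : hn (x + y) ^+ 2 = hn x ^+ 2 + hn y ^+ 2 + 2 * Re (inner x y).
Proof.
by rewrite !hn_sqr_Re dnormD !raddfD/= complex_Re_conj; ring.
Qed.

Lemma hn_sqrB x y : hn (x - y) ^+ 2 = hn x ^+ 2 + hn y ^+ 2 - 2 * Re (inner x y).
Proof. by rewrite hn_sqrD hnN linearNr raddfN/= mulrN. Qed.

Lemma parallelogram x y :
  hn (x + y) ^+ 2 + hn (x - y) ^+ 2 = 2 * (hn x ^+ 2 + hn y ^+ 2).
Proof. by rewrite hn_sqrD hn_sqrB; ring. Qed.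

Lemma pythagoras x y : inner x y = 0 -> hn (x + y) ^+ 2 = hn x ^+ 2 + hn y ^+ 2.
Proof. by move=> xy; rewrite hn_sqrD xy mulr0 addr0. Qed.

Lemma inner_eq0_sym x y : inner x y = 0 -> inner y x = 0.
Proof. by move=> xy; rewrite innerC xy rmorph0. Qed.

Lemma inner_self_eq0 x : inner x x = 0 -> x = 0.
Proof. by move=> /eqP; rewrite dnorm_eq0 => /eqP. Qed.

Lemma inner_ext x y : (forall z, inner x z = inner y z) -> x = y.
Proof.
move=> xy; apply/eqP; rewrite -subr_eq0; apply/eqP/inner_self_eq0.
by rewrite linearBl /= xy subrr.
Qed.

Lemma cauchy_schwarz x y : `|inner x y| <= (hn x * hn y)%:C%C.
Proof.
have [->|y0] := eqVneq y 0; first by rewrite linear0r normr0 hn0 mulr0.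
have hy : 0 < hn y by rewrite lt_def hn_ge0 andbT; apply: contra_neq y0 => /hn_eq0.
set b := inner x y; pose c := b / inner y y.
have yy : inner y y != 0 by rewrite dnorm_eq0.
(* [c *: y] is the component of x along y; the squared norm of the remainder is |x|^2 - |b|^2 /
   |y|^2. *)
have : 0 <= inner (x - c *: y) (x - c *: y) by [].
rewrite dnormB dnormZ linearZr_LR/= -/b.
have -> : c^* * b = `|b| ^+ 2 / inner y y.
  rewrite /c rmorphM fmorphV/= -innerC mulrAC; congr (_ / _).
  by rewrite mulrC -normCK.
have -> : `|c| ^+ 2 * inner y y = `|b| ^+ 2 / inner y y.
  rewrite /c normrM normfV (ger0_norm (dnorm_ge0 _ y)).
  by rewrite exprMn -mulrA; congr (_ * _); field.
rewrite [X in _ + _ - (_ + X)]conj_Creal; last first.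
  by rewrite ger0_real// mulr_ge0// ?invr_ge0 ?dnorm_ge0// exprn_ge0.
have -> u v : u + v - (v + v) = u - v :> R[i] by ring.
rewrite subr_ge0 ler_pdivrMr; last by rewrite dnorm_gt0.
rewrite !hn_sqr -rmorphM/= -exprMn rmorphXn/=.
by rewrite ler_pXn2r// nnegrE ?normr_ge0// ler0c mulr_ge0 ?hn_ge0.
Qed.

Lemma Re_le_norm a (t : R) : `|a| <= t%:C%C -> Re a <= t.
Proof.
move=> at_; rewrite -lecR; apply: le_trans at_; apply: le_trans (normc_ge_Re a).
by rewrite lecR ler_norm.
Qed.

Lemma Re_cauchy_schwarz x y : Re (inner x y) <= hn x * hn y.
Proof. exact/Re_le_norm/cauchy_schwarz. Qed.

(** Completeness with a rate: the Cauchy bound survives in the limit. Every limit taken below thus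
    carries an explicit error estimate. *)
Lemma hn_lim (u : nat -> H) (b : nat -> R) :
  (forall e, 0 < e -> exists n, b n < e) ->
  (forall n m, (n <= m)%N -> hn (u m - u n) <= b n) ->
  exists l, forall n, hn (l - u n) <= b n.
Proof.
move=> b0 ub.
have uc : cauchy (u @ \oo).
  apply: cauchy_exP => e e0.
  have eR : (Re e)%:C%C = e by rewrite RRe_real// gtr0_real.
  have [n bn] : exists n, b n < Re e by apply: b0; rewrite -ltcR eR.
  exists (u n); exists n => // m /= nm; rewrite -ball_normE/= hnE -eR ltcR.
  by rewrite -hnN opprB; apply: le_lt_trans bn; exact: ub.
have /cauchy_cvg/cvg_ex[l ul] := uc; exists l => n; apply/ler_addgt0Pr => e e0.
have /cvgrPdist_lt/(_ e%:C%C) := ul; rewrite ltcR => /(_ e0)[m _ um].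
have := um (maxn m n) (leq_maxl _ _); rewrite /= hnE ltcR => lum.
have -> : l - u n = (l - u (maxn m n)) + (u (maxn m n) - u n) by rewrite subrKA.
apply: le_trans (hnD _ _) _; rewrite addrC; apply: lerD; last exact: ltW.
exact/ub/leq_maxr.
Qed.

End RealNorm.

(** * Bounded operators and norm estimates *)

Section Operators.
Context {R : realType}.
Implicit Types H K L : hilbertType R.

Lemma bop_ext H K (S T : 'B(H, K)) : (forall x, S x = T x) -> S = T.
Proof. by move=> ST; apply/val_inj/funext. Qed.

(* Rewriting with linearD and the like leaves a GRing.Linear coercion whose
   simplification would unfold the operator. *)
Lemma bopD H K (T : 'B(H, K)) x y : T (x + y) = T x + T y.
Proof. exact: linearD. Qed.

Lemma bopB H K (T : 'B(H, K)) x y : T (x - y) = T x - T y.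
Proof. exact: linearB. Qed.

Lemma bopN H K (T : 'B(H, K)) x : T (- x) = - T x.
Proof. exact: linearN. Qed.

Lemma bopZ H K (T : 'B(H, K)) a x : T (a *: x) = a *: T x.
Proof. exact: linearZ. Qed.

Lemma bop0 H K (T : 'B(H, K)) : T 0 = 0.
Proof. exact: linear0. Qed.

Lemma bop_bounded H K (T : 'B(H, K)) :
  exists M : R, 0 <= M /\ forall x, hn (T x) <= M * hn x.
Proof.
have /linear_bounded_continuous/linear_boundedP/pinfty_ex_gt0[r r0 Tr] :
  continuous T := bop_continuous T.
have rE : (Re r)%:C%C = r by rewrite RRe_real// gtr0_real.
exists (Re r); split; first by rewrite -ler0c rE ltW.
by move=> x; rewrite -lecR rmorphM/= rE -!hnE; exact: Tr.
Qed.

(** Turns maps obtained by pointwise choice (projections, adjoints, inverses, limits) into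
    operators. *)
Lemma bop_of_bounded H K (f : H -> K) (M : R) : linear f ->
  (forall x, hn (f x) <= M * hn x) -> exists T : 'B(H, K), forall x, T x = f x.
Proof.
move=> fl fM.
suff fB : f \in @bounded_linear R H K by exists (Bop fB).
apply/asboolP; split => //.
pose g : {linear H -> K} := HB.pack f (GRing.isLinear.Build R[i] H K _ f fl).
apply: (@bounded_linear_continuous _ _ _ g); apply/linear_boundedP.
near=> r => x; apply: (@le_trans _ _ (M%:C%C * `|x|)).
  by rewrite !hnE -rmorphM/= lecR; exact: fM.
apply: ler_wpM2r => //; near: r; apply: nbhs_pinfty_ge.
by apply/complex_realP; exists M.
Unshelve. all: by end_near. Qed.

Lemma continuous_innerl H (y : H) : continuous (fun x : H => inner x y : R[i]^o).
Proof.
move=> x; apply/cvgrPdist_lt => e e0.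
have eR : (Re e)%:C%C = e by rewrite RRe_real// gtr0_real.
(* The summand 1 covers the case y = 0. *)
have d0 : 0 < e / (hn y + 1)%:C%C.
  by rewrite divr_gt0// ltcR ltr_wpDl ?hn_ge0.
near=> z; rewrite -linearBl; apply: le_lt_trans (cauchy_schwarz _ _) _.
apply: (@le_lt_trans _ _ (`|x - z| * (hn y + 1)%:C%C)).
  by rewrite rmorphM/= -hnE ler_wpM2l// lecR lerDl.
rewrite -ltr_pdivlMr ?ltcR ?ltr_wpDl ?hn_ge0//; near: z.
Unshelve. all: by end_near. Qed.

End Operators.

(** * Orthogonal projections and adjoints *)

Section OrthogonalProjection.
Context {R : realType} {H : hilbertType R}.

Lemma small_inv (c e : R) : 0 <= c -> 0 < e -> exists n : nat, c * n.+1%:R^-1 < e.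
Proof.
move=> c0 e0; pose n := Num.bound (c / e); exists n.
rewrite -ltr_pdivlMr ?invr_gt0 ?ltr0Sn// invrK -ltr_pdivrMl// mulrC.
have : c / e < n%:R by rewrite archi_boundP// divr_ge0// ltW.
by move=> /lt_trans; apply; rewrite ltr_nat.
Qed.

Lemma cs_setZ (M : csubspace H) a x : cs_set M x -> cs_set M (a *: x).
Proof. by move=> /asboolP Mx; apply/asboolP; exact: (@rpredZ _ _ (cs_mem M)). Qed.

Lemma cs_setD (M : csubspace H) x y :
  cs_set M x -> cs_set M y -> cs_set M (x + y).
Proof.
by move=> /asboolP Mx /asboolP My; apply/asboolP; exact: (@rpredD _ (cs_mem M)).
Qed.

Lemma best_approximation (M : csubspace H) (x : H) :
  exists2 p, cs_set M p & forall y, cs_set M y -> hn (x - p) <= hn (x - y).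
Proof.
have [M0 ML] := cs_linear M.
pose D := [set hn (x - y) | y in cs_set M].
have Dinf : has_inf D.
  split; first by exists (hn (x - 0)), 0.
  by exists 0 => _ [y _ <-]; exact: hn_ge0.
pose d := inf D.
have dle y : cs_set M y -> d <= hn (x - y).
  by move=> My; apply: ge_inf; [exact: Dinf.2 | exists y].
have d0 : 0 <= d.
  by apply: lb_le_inf; [exact: Dinf.1 | move=> _ [y _ <-]; exact: hn_ge0].
pose e (n : nat) : R := n.+1%:R^-1.
have e_gt0 n : 0 < e n by rewrite invr_gt0 ltr0Sn.
have e_le1 n : e n <= 1 by rewrite invf_le1 ?ltr0Sn// ler1n.
(* By the parallelogram law, two points of M within d + delta of x have squared distance at most 4
   ((d + delta)^2 - d^2), which is at most 4 (2 d + 1) delta when delta <= 1. This choice makes the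
   bound (2 e)^2. *)
pose delta n := e n ^+ 2 / (2 * d + 1).
have c_gt0 : 0 < 2 * d + 1 by lra.
have deltaE n : (2 * d + 1) * delta n = e n ^+ 2 by rewrite mulrC divfK// gt_eqF.
have delta_gt0 n : 0 < delta n by rewrite divr_gt0// exprn_gt0.
have delta_le1 n : delta n <= 1.
  rewrite ler_pdivrMr// mul1r; have := e_le1 n; have := e_gt0 n; nra.
have /choice[u uP] n : exists y, cs_set M y /\ hn (x - y) <= d + delta n.
  have [_ [y My <-] /ltW yd] := inf_adherent (delta_gt0 n) Dinf.
  by exists y.
have uu n m : (n <= m)%N -> hn (u m - u n) <= 2 * e n.
  move=> nm; have [Mn dn] := uP n; have [Mm dm] := uP m.
  have dm' : hn (x - u m) <= d + delta n.
    apply: le_trans dm _; rewrite lerD2l ler_pM2r ?invr_gt0//.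
    by rewrite ler_pXn2r ?nnegrE ?(ltW (e_gt0 _))// /e lef_pV2 ?posrE ?ltr0Sn// ler_nat.
  have mid : d <= hn (x - 2^-1 *: (u n + u m)).
    by apply/dle/cs_setZ/cs_setD.
  have := parallelogram (x - u n) (x - u m).
  have -> : x - u n + (x - u m) = (2%:R)%:C%C *: (x - 2^-1 *: (u n + u m)).
    rewrite rmorph_nat scalerBr scalerA divff ?pnatr_eq0// scale1r scaler_nat mulr2n.
    by rewrite addrACA opprD.
  have -> : x - u n - (x - u m) = u m - u n by rewrite opprB addrC addrA subrK.
  rewrite hnZr// => par.
  rewrite -(@ler_pXn2r _ 2)// ?nnegrE ?hn_ge0 ?mulr_ge0 ?(ltW (e_gt0 _))//.
  have := deltaE n; have := delta_le1 n; have := delta_gt0 n.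
  have := hn_ge0 (x - u n); have := hn_ge0 (x - u m).
  move: par mid dm' dn d0.
  move: (hn _) (hn (x - u n)) (hn (x - u m)) (hn (u m - u n)) (delta n) (e n).
  move=> a b c f g k; nra.
have [|p pP] := hn_lim _ uu.
  by move=> t t0; apply: small_inv.
have Mp : cs_set M p.
  apply: cs_closed => B /nbhs_ballP[t /= t0 tB].
  have tR : (Re t)%:C%C = t by rewrite RRe_real// gtr0_real.
  have [n nt] : exists n, 2 * e n < Re t by apply: small_inv; rewrite // -ltcR tR.
  exists (u n); split; first exact: (uP n).1.
  apply: tB; rewrite -ball_normE/= hnE -tR ltcR.
  by apply: le_lt_trans nt; exact: pP.
exists p => // y My; apply: (@le_trans _ _ d); last exact: dle.
apply/ler_addgt0Pr => t t0.
have [n nt] : exists n, 3 * e n < t by apply: small_inv.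
have -> : x - p = (x - u n) - (p - u n) by rewrite opprB addrA subrK.
apply: le_trans (hnB _ _) _.
have := (uP n).2; have := pP n; have := deltaE n; have := delta_gt0 n.
have := e_le1 n; have := e_gt0 n; nra.
Qed.

Lemma orthogonal_projection (M : csubspace H) (x : H) :
  exists2 p, cs_set M p & forall y, cs_set M y -> inner (x - p) y = 0.
Proof.
have [p Mp pmin] := best_approximation M x; exists p => // y My.
have [->|y0] := eqVneq y 0; first by rewrite linear0r.
have hy : 0 < hn y by rewrite lt_def hn_ge0 andbT; apply: contra_neq y0 => /hn_eq0.
set b := inner (x - p) y; pose s := hn y ^- 2; pose c := s%:C%C * b.
have s0 : 0 < s by rewrite invr_gt0 exprn_gt0.
have [nb bE] : exists nb, `|b| = nb%:C%C by apply/complex_realP; exact: normr_real.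
(* Moving p by [c *: y] lowers the squared distance to x by |b|^2 / |y|^2, so minimality forces b =
   0. *)
have := pmin (c *: y + p) (cs_setD (cs_setZ _ My) Mp).
rewrite -(@ler_pXn2r _ 2)// ?nnegrE ?hn_ge0//.
have -> : x - (c *: y + p) = (x - p) - c *: y by rewrite opprD addrCA addrC.
rewrite [hn (x - p - _) ^+ 2]hn_sqrB linearZr_LR/= -/b rmorphM/=.
rewrite conj_real -mulrA [_ * b]mulrC -normCK.
have -> : hn (c *: y) = s * nb * hn y.
  by rewrite /c -scalerA hnZr ?ltW// hnZ bE mulrA.
rewrite bE -rmorphXn -rmorphM [Re _]/=.
have -> : (s * nb * hn y) ^+ 2 = s * nb ^+ 2.
  by rewrite !exprMn mulrAC -mulrA mulrAC -mulrA /s; field; rewrite gt_eqF.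
have snb : 0 <= s * nb ^+ 2 by rewrite mulr_ge0 ?sqr_ge0 ?ltW.
move=> le0; have /eqP : s * nb ^+ 2 = 0 by apply/eqP; rewrite eq_le snb andbT; lra.
rewrite mulf_eq0 gt_eqF//= expf_eq0/= => /eqP nb_eq0.
by apply/eqP; rewrite -normr_eq0 bE nb_eq0.
Qed.

Lemma projBP (M : csubspace H) :
  forall x (z : subsp M), inner (x - val (projB M x)) (val z) = 0.
Proof.
suff : exists P : 'B(H, subsp M),
    forall x (z : subsp M), inner (x - val (P x)) (val z) = 0.
  move=> /cid[P PP].
  exact: (@xgetPex _ 0 [set P : 'B(H, subsp M) | _] (ex_intro _ P PP)).
have /choice[f fP] x : exists p : subsp M,
    forall z : subsp M, inner (x - val p) (val z) = 0.
  have [p /asboolP Mp pP] := orthogonal_projection M x.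
  by exists (SubSp Mp) => -[z /= /asboolP Mz]; exact: pP.
have f_uniq x (q : subsp M) :
    (forall z : subsp M, inner (x - val q) (val z) = 0) -> f x = q.
  move=> qP; apply: inner_ext => z; apply/eqP; rewrite -subr_eq0; apply/eqP.
  have E : val (f x) - val q = (x - val q) - (x - val (f x)).
    by rewrite opprB [RHS]addrC addrA subrK.
  rewrite -[LHS]/(inner (val (f x)) (val z) - inner (val q) (val z)).
  by rewrite -linearBl/= E linearBl/= qP fP subrr.
have fl : linear f.
  move=> a x y; apply: f_uniq => z.
  have -> : val (a *: f x + f y) = a *: val (f x) + val (f y) by rewrite linearP.
  rewrite opprD addrACA -scalerBr linearDl linearZl_LR/=.
  by rewrite !fP mulr0 addr0.
have fB x : hn (f x) <= 1 * hn x.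
  rewrite mul1r -(@ler_pXn2r _ 2)// ?nnegrE ?hn_ge0//.
  rewrite -{2}(subrK (val (f x)) x) pythagoras ?fP//.
  by rewrite lerDr exprn_ge0 ?hn_ge0.
have [P PE] := bop_of_bounded fl fB.
by exists P => x z; rewrite PE.
Qed.

End OrthogonalProjection.

Section Adjoint.
Context {R : realType}.
Implicit Types H K L : hilbertType R.

Lemma riesz H (f : H -> R[i]^o) : linear f -> continuous f ->
  exists y, forall x, f x = inner x y.
Proof.
move=> fl fc.
have f_linear_set : linear_set [set x | f x = 0].
  split=> [|a x y /= fx fy]; last by rewrite fl fx fy scaler0 addr0.
  by rewrite /= -[X in f X](addr0 0) -[X in f (X + _)](scaler0 _ (-1)) fl scaleN1r addNr.
have f_closed : closed [set x | f x = 0].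
  have -> : [set x | f x = 0] = f @^-1` [set 0] by [].
  move/continuous_closedP : fc; apply.
  exact/accessible_closed_set1/hausdorff_accessible/norm_hausdorff.
pose M := CSubspace f_linear_set f_closed.
have [[z fz]|f0] := pselect (exists z, f z != 0); last first.
  exists 0 => x; rewrite linear0r; apply/eqP.
  by apply: contra_notT f0 => fx; exists x.
have [p Mp pP] := orthogonal_projection M z.
pose w := z - p.
have fB x y : f (x - y) = f x - f y.
  by rewrite -[x - y]addrC -scaleN1r fl scaleN1r addrC.
have fw : f w != 0 by rewrite /w fB [f p]Mp subr0.
have ww : inner w w != 0.
  by rewrite dnorm_eq0; apply: contraNneq fw => ->; rewrite f_linear_set.1.
(* The conjugate compensates for the antilinearity of [inner] in its second argument. As w is
   orthogonal to ker f, testing it against x - (f x / f w) w, which lies in ker f, gives the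
   formula. *)
exists ((f w / inner w w)^* *: w) => x.
have Mx : cs_set M (x - (f x / f w) *: w).
  rewrite /=/M/= fB -[_ *: w]addr0 fl f_linear_set.1 addr0.
  by rewrite /GRing.scale/= divfK// subrr.
have := pP _ Mx => /inner_eq0_sym; rewrite -/w linearBl linearZl_LR/=.
move=> /eqP; rewrite subr_eq0 => /eqP xw.
by rewrite linearZr_LR/= conjCK xw mulrC -mulrA mulrC; field; rewrite fw ww.
Qed.

Lemma adjBP H K (T : 'B(H, K)) x y : inner (T x) y = inner x (adjB T y).
Proof.
suff [S SP] : exists S : 'B(K, H), forall x y, inner (T x) y = inner x (S y).
  have := @xgetPex _ 0 [set S : 'B(K, H) | forall x y,
    inner (T x) y = inner x (S y)] (ex_intro _ S SP); exact.
have /choice[f fP] v : exists w, forall u, inner (T u) v = inner u w.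
  apply: (@riesz H (fun u => inner (T u) v)).
    by move=> a u w; rewrite linearP linearPl.
  move=> u; apply: (@continuous_comp _ _ _ T (fun w => inner w v : R[i]^o)).
    exact: bop_continuous.
  exact: continuous_innerl.
have fl : linear f.
  move=> a u v; apply: inner_ext => w; rewrite innerC -fP linearDr linearZr_LR/=.
  by rewrite !fP linearDl linearZl_LR/= rmorphD rmorphM/= conjCK -!innerC.
have [C [C0 TC]] := bop_bounded T.
(* |f u|^2 = Re <T (f u), u> <= C |f u| |u|; divide by |f u| if it is not 0. *)
have fB u : hn (f u) <= C * hn u.
  have := Re_cauchy_schwarz (T (f u)) u; rewrite fP -hn_sqr_Re => le1.
  have := TC (f u); have := hn_ge0 (f u); have := hn_ge0 u.
  move: le1; move: (hn (f u)) (hn u) (hn (T (f u))) => a b c.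
  move=> le1 b0 a0 cle; have [->|an0] := eqVneq a 0; first exact: mulr_ge0.
  have apos : 0 < a by rewrite lt_def an0.
  by rewrite -(ler_pM2l apos); nra.
have [S SE] := bop_of_bounded fl fB.
by exists S => u v; rewrite SE.
Qed.

Lemma adjB_uniq H K (T : 'B(H, K)) (S : 'B(K, H)) :
  (forall x y, inner (T x) y = inner x (S y)) -> adjB T = S.
Proof.
move=> TS; apply: bop_ext => y; apply: inner_ext => x.
by rewrite innerC -adjBP TS -innerC.
Qed.

Lemma adjBP' H K (T : 'B(H, K)) x y : inner (adjB T x) y = inner x (T y).
Proof. by rewrite innerC -adjBP -innerC. Qed.

End Adjoint.
(** * Positive operators and square roots *)

Section PositiveOperators.
Context {R : realType} {H : hilbertType R}.
Implicit Types A S T : 'B(H, H).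

Definition self_adjoint A := forall x y, inner (A x) y = inner x (A y).

Lemma adjB_self_adjoint A : adjB A = A -> self_adjoint A.
Proof. by move=> AA x y; rewrite adjBP AA. Qed.

Lemma Im_inner_self_adjoint A x : self_adjoint A -> Im (inner (A x) x) = 0.
Proof.
move=> sA; have := congr1 (@complex.Im R) (innerC (A x) x).
by rewrite -sA complex_Im_conj; lra.
Qed.

Lemma positiveB_self_adjoint A :
  self_adjoint A -> (forall x, 0 <= Re (inner (A x) x)) -> positiveB A.
Proof.
by move=> sA A0 x; rewrite lecE/= Im_inner_self_adjoint// eqxx A0.
Qed.

Lemma inner_polar A x y : inner (A (x + y)) (x + y) =
  inner (A x) x + inner (A y) y + (inner (A x) y + inner (A y) x).
Proof. by rewrite [A _]linearD linearDl 2!linearDr/=; ring. Qed.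

(** Polarization over the complex scalars: reality of the form at x + y compares the imaginary parts
    of <A x, y> and <A y, x>, and reality at x + i y compares their real parts. *)
Lemma self_adjoint_positiveB A : positiveB A -> self_adjoint A.
Proof.
move=> A0 x y.
have Im0 z : Im (inner (A z) z) = 0 by exact/ger0_Im/A0.
have := Im0 (x + y); rewrite inner_polar 2!raddfD/= !Im0 !add0r raddfD/=.
have := Im0 (x + 'i%C *: y); rewrite inner_polar 2!raddfD/= !Im0 !add0r.
rewrite [A (_ *: _)]linearZ linearZl_LR linearZr_LR/= [inner x _]innerC.
case: (inner (A x) y) => a b; case: (inner (A y) x) => c d /=.
move=> h1 h2.
by apply/eqP; rewrite eq_complex/=; apply/andP; split; apply/eqP; lra.
Qed.

Lemma small_inv_le (t c : R) : 0 <= c -> (forall n : nat, t <= c * n.+1%:R^-1) -> t <= 0.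
Proof.
move=> c0 tc; rewrite leNgt; apply/negP => t0.
by have [n] := small_inv c0 t0; rewrite ltNge tc.
Qed.

(** The lower bound makes A injective with closed range. A vector orthogonal to the range lies in
    ker A by self-adjointness, hence is 0, so A is onto. *)
Lemma self_adjoint_bounded_below_inverse A (c : R) :
  self_adjoint A -> 0 < c -> (forall x, c * hn x <= hn (A x)) ->
  exists B : 'B(H, H), (forall x, B (A x) = x) /\ (forall x, A (B x) = x).
Proof.
move=> sA c0 cA.
have A0 x : hn (A x) <= 0 -> x = 0.
  move=> Ax; apply: hn_eq0; apply/eqP; rewrite eq_le hn_ge0 andbT.
  by rewrite -(pmulr_rle0 _ c0) (le_trans (cA x)).
have [M [M0 AM]] := bop_bounded A.
have range_closed : closed (range A).
  move=> v vA; pose e (n : nat) : R := n.+1%:R^-1.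
  have e_gt0 n : 0 < e n by rewrite invr_gt0 ltr0Sn.
  have /choice[u uP] n : exists x, hn (v - A x) <= e n.
    have [|_ [[x _ <-]]] := vA (ball v (e n)%:C%C).
      by apply: nbhsx_ballx; rewrite ltcR.
    by rewrite -ball_normE/= hnE ltcR => /ltW; exists x.
  have uu n m : (n <= m)%N -> hn (u m - u n) <= 2 / c * e n.
    move=> nm; have emn : e m <= e n by rewrite /e lef_pV2 ?posrE ?ltr0Sn// ler_nat.
    rewrite mulrAC ler_pdivlMr// mulrC; apply: le_trans (cA _) _.
    rewrite linearB/=.
    have -> : A (u m) - A (u n) = (v - A (u n)) - (v - A (u m)).
      by rewrite opprB [RHS]addrC addrA subrK.
    apply: le_trans (hnB _ _) _; have := uP n; have := uP m; lra.
  have [|l lP] := hn_lim _ uu.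
    by move=> t t0; apply: small_inv => //; rewrite divr_ge0// ltW.
  exists l => //; apply/eqP; rewrite -subr_eq0; apply/eqP/hn_eq0/eqP.
  rewrite eq_le hn_ge0 andbT.
  apply: (@small_inv_le _ (M * (2 / c) + 1)).
    by rewrite addr_ge0// mulr_ge0// divr_ge0// ltW.
  move=> n; have -> : A l - v = A (l - u n) - (v - A (u n)).
    by rewrite linearB/= opprB addrA subrK.
  apply: le_trans (hnB _ _) _; rewrite mulrDl mul1r; apply: lerD (uP n).
  by apply: le_trans (AM _) _; rewrite -mulrA ler_wpM2l.
pose N := CSubspace (linear_set_range A) range_closed.
have /choice[f fP] y : exists x, A x = y.
  have [_ [x _ <-] xP] := orthogonal_projection N y; exists x.
  apply/eqP; rewrite -subr_eq0 -oppr_eq0 opprB; apply/eqP/A0.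
  suff -> : A (y - A x) = 0 by rewrite hn0.
  by apply: inner_ext => z; rewrite sA linear0l; apply: xP; exists z.
have Ainj x y : A x = A y -> x = y.
  move=> Axy; apply/eqP; rewrite -subr_eq0; apply/eqP/A0.
  by rewrite linearB/= Axy subrr hn0.
have fl : linear f.
  by move=> a x y; apply: Ainj; rewrite linearP/= !fP.
have fB x : hn (f x) <= c^-1 * hn x.
  by rewrite mulrC ler_pdivlMr// mulrC (le_trans (cA _))// fP.
have [B BE] := bop_of_bounded fl fB.
by exists B; split=> x; rewrite BE//; apply: Ainj; rewrite fP.
Qed.

Lemma small_exp (r c e : R) : 0 <= r < 1 -> 0 < e -> exists n : nat, c * r ^+ n < e.
Proof.
move=> /andP[r0 r1] e0.
have /cvgrPdist_lt/(_ e e0)[n _] : (fun n => c * r ^+ n : R^o) @ \oo --> (0 : R^o).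
  by rewrite -[X in _ --> X](mulr0 c); apply: cvgMr; apply: cvg_expr; rewrite ger0_norm.
move=> /(_ n (leqnn n)); rewrite /= sub0r normrN => cr; exists n.
exact: le_lt_trans (ler_norm _) cr.
Qed.

Lemma le_geometric (r c t u : R) : 0 <= r < 1 ->
  (forall n, t <= u + c * r ^+ n) -> t <= u.
Proof.
move=> r01 tu; apply/ler_addgt0Pr => e e0.
have [n ne] := small_exp c r01 e0.
by apply: le_trans (tu n) _; rewrite lerD2l ltW.
Qed.

Lemma eq0_geometric (r c : R) (v : H) : 0 <= r < 1 ->
  (forall n, hn v <= c * r ^+ n) -> v = 0.
Proof.
move=> r01 vc; apply: hn_eq0; apply/eqP; rewrite eq_le hn_ge0 andbT.
by apply: (@le_geometric r c) => // n; rewrite add0r.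
Qed.

(* With Y = 1 - S the equation S^2 = A reads Y = ((1 - A) + Y^2) / 2, which is
   solved by iterating the right-hand side from 0. *)
Lemma sqrtB_exists A (r : R) : self_adjoint A -> 0 <= r < 1 ->
  (forall x, hn (x - A x) <= r * hn x) ->
  exists S, [/\ positiveB S, forall x, S (S x) = A x &
    forall B : 'B(H, H), (forall x, B (A x) = A (B x)) ->
      forall x, B (S x) = S (B x)].
Proof.
move=> sA r01 Ar; have /andP[r0 r1] := r01.
pose Y n : 'B(H, H) := iter n (fun Y => 2^-1 *: ((bid H - A) + Y \oB Y)) 0.
have YS n x : Y n.+1 x = 2^-1 *: ((x - A x) + Y n (Y n x)) by [].
have half x : hn (2^-1 *: x) = 2^-1 * hn x.
  rewrite hnZ ger0_norm ?invr_ge0//; congr (_ * _).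
  apply: complexI; rewrite RRe_real; last by rewrite realV realn.
  by rewrite fmorphV rmorph_nat.
(* The induction closes because (r + r^2) / 2 <= r. *)
have Yr n x : hn (Y n x) <= r * hn x.
  elim: n x => [|n IH] x; first by rewrite hn0 mulr_ge0 ?hn_ge0.
  rewrite YS half; have := hnD (x - A x) (Y n (Y n x)); have := Ar x.
  have := IH (Y n x); have := IH x; have := hn_ge0 x => x0 le1.
  have le2 : hn (Y n x) <= hn x by nra.
  nra.
(* With a^2 - b^2 = a (a - b) + (a - b) b, which needs no commutation, both terms gain a factor r,
   and the factor 1/2 absorbs their number. *)
have Yc n k x : hn (Y (n + k)%N x - Y n x) <= r ^+ n * hn x.
  elim: n x => [|n IH] x.
    rewrite subr0 expr0; apply: le_trans (Yr _ _) _.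
    by apply: ler_wpM2r (hn_ge0 _) _ _ (ltW r1).
  rewrite addSn !YS -scalerBr half [x - A x + _]addrC addrKA.
  set a := Y (n + k)%N; set b := Y n.
  have -> : a (a x) - b (b x) = a (a x - b x) + (a (b x) - b (b x)).
    by rewrite linearB/= addrA subrK.
  have := hnD (a (a x - b x)) (a (b x) - b (b x)).
  have := Yr (n + k)%N (a x - b x); have := IH x; have := IH (b x).
  have := Yr n x; rewrite -/a -/b exprS.
  have : 0 <= r ^+ n by rewrite exprn_ge0.
  move: (hn (a (a x - b x) + _)) (hn (a (a x - b x))) (hn (a (b x) - b (b x))) => s t u.
  have := hn_ge0 x; move: (hn (a x - b x)) (hn (b x)) (hn x) (r ^+ n) => v w z q.
  move=> z0 q0 wz uq vq tv stu; nra.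
have /choice[f fP] x : exists l, forall n, hn (l - Y n x) <= hn x * r ^+ n.
  apply: hn_lim => [e|n m nm]; first exact: small_exp.
  by rewrite mulrC -(subnKC nm).
have fl : linear f.
  move=> a x y; apply/eqP; rewrite -subr_eq0; apply/eqP.
  apply: (@eq0_geometric r (hn (a *: x + y) + Re `|a| * hn x + hn y)) => // n.
  have -> : f (a *: x + y) - (a *: f x + f y) =
      (f (a *: x + y) - Y n (a *: x + y)) - (a *: (f x - Y n x) + (f y - Y n y)).
    rewrite [Y n (_ + _)]linearP scalerBr [a *: f x - _ + _]addrACA -opprD.
    by rewrite opprB addrA subrK.
  apply: le_trans (hnB _ _) _; rewrite !mulrDl -addrA; apply: lerD => //.
  apply: le_trans (hnD _ _) _; apply: lerD => //.
  rewrite hnZ -mulrA ler_wpM2l//.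
  by rewrite -ler0c RRe_real ?normr_ge0// normr_real.
have fB x : hn (f x) <= r * hn x.
  apply: (@le_geometric r (hn x)) => // n.
  rewrite -[f x](subrK (Y n x)) addrC; apply: le_trans (hnD _ _) _.
  by rewrite addrC [X in _ <= X]addrC; exact: lerD.
have [Z ZE] := bop_of_bounded fl fB.
have ZP n x : hn (Z x - Y n x) <= hn x * r ^+ n by rewrite ZE.
have Zr x : hn (Z x) <= r * hn x by rewrite ZE.
have Yself n : self_adjoint (Y n).
  elim: n => [|n IH] x y; first by rewrite linear0l linear0r.
  rewrite !YS linearZl_LR linearZr_LR/= linearDl linearDr/= linearBl linearBr/=.
  by rewrite sA !IH fmorphV/= rmorph_nat.
have Ycomm n (B : 'B(H, H)) : (forall x, B (A x) = A (B x)) ->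
    forall x, B (Y n x) = Y n (B x).
  move=> BA; elim: n => [|n IH] x; first by rewrite linear0.
  by rewrite !YS linearZ/= linearD/= linearB/= BA !IH.
have Zself : self_adjoint Z.
  move=> x y; apply/eqP; rewrite -subr_eq0; apply/eqP/normr0_eq0/eqP.
  rewrite eq_le normr_ge0 andbT.
  have [t tE] : exists t, `|inner (Z x) y - inner x (Z y)| = t%:C%C.
    by apply/complex_realP; exact: normr_real.
  rewrite tE lecR; apply: (@le_geometric r (2 * (hn x * hn y))) => // n.
  rewrite add0r -lecR -tE.
  have -> : inner (Z x) y - inner x (Z y) =
     inner (Z x - Y n x) y - inner x (Z y - Y n y).
    by rewrite linearBl linearBr/= Yself; ring.
  apply: le_trans (ler_normB _ _) _.
  apply: le_trans (lerD (cauchy_schwarz _ _) (cauchy_schwarz _ _)) _.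
  rewrite -rmorphD lecR/=.
  have := ZP n x; have := ZP n y; have := hn_ge0 x; have := hn_ge0 y.
  nra.
have Zfix x : Z x = 2^-1 *: ((x - A x) + Z (Z x)).
  apply/eqP; rewrite -subr_eq0; apply/eqP.
  apply: (@eq0_geometric r (2 * hn x)) => // n.
  have -> : Z x - 2^-1 *: (x - A x + Z (Z x)) = (Z x - Y n.+1 x) -
      2^-1 *: ((Z (Z x) - Y n (Z x)) + Y n (Z x - Y n x)).
    rewrite YS [Y n (_ - _)]linearB/= addrA subrK -[RHS]addrA -opprD -scalerDr.
    congr (_ - _ *: _).
    by rewrite -[RHS]addrA [Y n _ + _]addrC subrK.
  apply: le_trans (hnB _ _) _; rewrite half.
  have := hnD (Z (Z x) - Y n (Z x)) (Y n (Z x - Y n x)).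
  have := ZP n.+1 x; have := ZP n x; have := ZP n (Z x); have := Zr x.
  have := Yr n (Z x - Y n x); have := hn_ge0 x; rewrite exprS.
  have : 0 <= r ^+ n by rewrite exprn_ge0.
  move: (r ^+ n) => q q0 x0 h1 h2 h3 h4 h5.
  have w0 : 0 <= hn x * q by rewrite mulr_ge0.
  have rw : r * (hn x * q) <= hn x * q by rewrite ler_piMl// ltW.
  have h6 : hn (Z x) * q <= r * (hn x * q) by rewrite mulrA ler_wpM2r.
  have h7 : r * hn (Z x - Y n x) <= r * (hn x * q) by rewrite ler_wpM2l.
  have h8 : hn x * (r * q) = r * (hn x * q) by rewrite mulrCA.
  move: h1 h3 h5; rewrite h8; lra.
(* Positivity comes from |Z x| <= r |x|, the square from 2 Z = 1 - A + Z^2, and commutation from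
   that of every iterate [Y n]. *)
exists (bid H - Z); split.
- apply: positiveB_self_adjoint => [x y|x].
    by rewrite /= linearBl linearBr/= Zself.
  rewrite /= linearBl/= raddfB/= -hn_sqr_Re subr_ge0.
  apply: le_trans (Re_cauchy_schwarz _ _) _.
  have := Zr x; have := hn_ge0 x; nra.
- move=> x; rewrite -[LHS]/((x - Z x) - Z (x - Z x)) linearB/=.
  have -> : A x = x + Z (Z x) - 2%:R *: Z x.
    have -> : 2%:R *: Z x = x - A x + Z (Z x).
      by rewrite {1}Zfix scalerA divff ?pnatr_eq0// scale1r.
    by rewrite [x + _]addrC [x - _ + _]addrC opprD addrACA subrr add0r opprB addrC subrK.
  by rewrite opprB scaler_nat mulr2n opprD !addrA; congr (_ - _); rewrite addrAC.
- move=> B BA x; rewrite -[LHS]/(B (x - Z x)) -[RHS]/(B x - Z (B x)) linearB/=.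
  congr (_ - _).
  apply/eqP; rewrite -subr_eq0; apply/eqP.
  have [M [M0 BM]] := bop_bounded B.
  apply: (@eq0_geometric r (M * hn x + hn (B x))) => // n.
  have -> : B (Z x) - Z (B x) = B (Z x - Y n x) - (Z (B x) - Y n (B x)).
    by rewrite linearB/= Ycomm// opprB addrA subrK.
  apply: le_trans (hnB _ _) _; rewrite mulrDl; apply: lerD => //.
  by apply: le_trans (BM _) _; rewrite -mulrA ler_wpM2l.
Qed.

End PositiveOperators.
(** * The matched projection of an idempotent *)

Section MatchedProjectionTheory.
Context {R : realType} {H : hilbertType R}.
Implicit Types A P S T : 'B(H, H).

Lemma bop_congr {K : hilbertType R} (S T : 'B(H, K)) : S = T -> S =1 T.
Proof. by move=> ->. Qed.

Lemma self_adjoint_adjB A : self_adjoint A -> adjB A = A.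
Proof. exact: adjB_uniq. Qed.

Lemma adjBK {K : hilbertType R} (T : 'B(H, K)) : adjB (adjB T) = T.
Proof. by apply: adjB_uniq => x y; rewrite adjBP'. Qed.

Lemma hn_self_adjoint_sqr A x : self_adjoint A ->
  hn (A x) ^+ 2 = Re (inner (A (A x)) x).
Proof. by move=> sA; rewrite hn_sqr_Re -sA. Qed.

Lemma orthogonal_projection_op (M : csubspace H) :
  exists P, [/\ self_adjoint P, forall x, cs_set M (P x) &
    forall x, cs_set M x -> P x = x].
Proof.
have [C [_ CP]] := bop_bounded (projB M).
have fl : linear (fun x => val (projB M x)) by move=> a x y; rewrite !linearP.
have [P PE] := bop_of_bounded fl CP; exists P; split.
- move=> x y; rewrite !PE.
  have := projBP x (projB M y); have := projBP y (projB M x).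
  move=> /inner_eq0_sym; rewrite linearBr linearBl/= => /eqP; rewrite subr_eq0.
  by move=> /eqP -> /eqP; rewrite subr_eq0 => /eqP ->.
- by move=> x; rewrite PE; case: (projB M x) => p /= /asboolP.
- move=> x /asboolP Mx; rewrite PE; apply/esym/eqP; rewrite -subr_eq0.
  apply/eqP/inner_self_eq0.
  have -> : inner (x - val (projB M x)) (x - val (projB M x)) =
      inner (x - val (projB M x)) (val (SubSp Mx - projB M x)) by rewrite raddfB.
  exact: projBP.
Qed.

(** Rescaling to reach the iteration: if A >= 1 has norm at most M and d = M^-2, then |x - d A x|^2
    <= (1 - 2 d + d^2 M^2) |x|^2 = (1 - d) |x|^2, whence r = sqrt (1 - d). The root of d A is
    multiplied back by M. *)
Lemma ge1_sqrtB_exists A : self_adjoint A ->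
  (forall x, hn x ^+ 2 <= Re (inner (A x) x)) ->
  exists S, [/\ positiveB S, forall x, S (S x) = A x &
    forall B : 'B(H, H), (forall x, B (A x) = A (B x)) ->
      forall x, B (S x) = S (B x)].
Proof.
move=> sA A1; have [M0 [M00 AM0]] := bop_bounded A.
pose M := M0 + 1; have M1 : 1 <= M by rewrite /M; lra.
have M_gt0 : 0 < M by lra.
have AM x : hn (A x) <= M * hn x.
  by apply: le_trans (AM0 _) _; rewrite ler_wpM2r ?hn_ge0// /M; lra.
pose d := M^-1 ^+ 2.
have d_gt0 : 0 < d by rewrite exprn_gt0// invr_gt0.
have dM : d * M ^+ 2 = 1 by rewrite /d -exprMn mulVf ?expr1n// gt_eqF.
have d1 : d <= 1 by rewrite /d expr_le1 ?invr_ge0 ?invf_le1// ltW.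
pose r := Num.sqrt (1 - d).
have r0 : 0 <= r by rewrite sqrtr_ge0.
have r2 : r ^+ 2 = 1 - d by rewrite sqr_sqrtr// subr_ge0.
have r1 : r < 1 by rewrite -(@ltr_pXn2r _ 2)// ?nnegrE// r2 expr1n; lra.
have [|||T [T0 TT Tcomm]] := @sqrtB_exists _ _ (d%:C%C *: A) r.
- by move=> x y; rewrite linearZl_LR linearZr_LR/= sA conj_real.
- by rewrite r0.
- move=> x; rewrite -(@ler_pXn2r _ 2)// ?nnegrE ?mulr_ge0 ?hn_ge0//.
  rewrite exprMn r2 hn_sqrB (hnZr _ (ltW d_gt0)) linearZr_LR/= conj_real.
  have -> : Re (d%:C%C * inner x (A x)) = d * Re (inner (A x) x).
    by rewrite -sA; case: (inner (A x) x) => a b /=; rewrite mul0r subr0.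
  have := A1 x; have := AM x; have := hn_ge0 x; have := hn_ge0 (A x).
  move: (hn (A x)) (hn x) (Re _) => a b c a0 b0 ab bc.
  have a2 : a ^+ 2 <= M ^+ 2 * b ^+ 2.
    by rewrite -exprMn ler_pXn2r ?nnegrE// mulr_ge0// ltW.
  have da2 : d * a ^+ 2 <= b ^+ 2.
    by have := ler_wpM2l (ltW d_gt0) a2; rewrite [d * (M ^+ 2 * _)]mulrA dM mul1r.
  have da4 : d ^+ 2 * a ^+ 2 <= d * b ^+ 2 by rewrite expr2 -mulrA ler_wpM2l// ltW.
  have dbc : d * b ^+ 2 <= d * c by rewrite ler_wpM2l// ltW.
  rewrite exprMn.
  lra.
exists (M%:C%C *: T); split.
- by move=> x; rewrite linearZl_LR/= mulr_ge0// ler0c ltW.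
- move=> x; rewrite -[LHS]/(M%:C%C *: T (M%:C%C *: T x)) linearZ/= scalerA TT.
  by rewrite -[_ *: _]/(_ *: (d%:C%C *: A x)) scalerA -!rmorphM/= mulrC -expr2 dM scale1r.
- move=> B BA x; rewrite -[LHS]/(B (M%:C%C *: T x)) linearZ/= Tcomm// => y.
  by rewrite -[LHS]/(B (d%:C%C *: A y)) linearZ/= BA.
Qed.

Lemma add1_inverse S : positiveB S ->
  exists B : 'B(H, H), (S + bid H) \oB B = bid H /\ B \oB (S + bid H) = bid H.
Proof.
move=> S0; have sS := self_adjoint_positiveB S0.
have [|||B [BS SB]] := @self_adjoint_bounded_below_inverse _ _ (S + bid H) 1.
- by move=> x y; rewrite linearDl linearDr/= sS.
- exact: ltr01.
- move=> x; rewrite mul1r.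
  have := Re_cauchy_schwarz ((S + bid H) x) x.
  rewrite linearDl/= raddfD/= -hn_sqr_Re.
  have : 0 <= Re (inner (S x) x) by have := S0 x; rewrite lecE => /andP[].
  have := hn_ge0 x; have := hn_ge0 ((S + bid H) x).
  move: (hn (_ x)) (hn x) (Re _) => a b c a0 b0 c0 le1.
  by rewrite leNgt; apply/negP => ab; nra.
by exists B; split; apply: bop_ext.
Qed.


Section Idempotent.
Variables (Q : 'B(H, H)) (Qidem : idempotentB Q).
Let Q' := adjB Q.

Lemma idempotentE x : Q (Q x) = Q x.
Proof. by rewrite -[LHS]/((Q \oB Q) x) Qidem. Qed.

Lemma adj_idempotentE x : Q' (Q' x) = Q' x.
Proof. by apply: inner_ext => y; rewrite !adjBP' idempotentE. Qed.

Lemma closed_range_idempotent : closed (range Q).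
Proof.
have -> : range Q = kerB (bid H - Q).
  apply/seteqP; split=> [_ [x _ <-]|x] /=; rewrite /kerB /=.
    by rewrite -[LHS]/(Q x - Q (Q x)) idempotentE subrr.
  by rewrite -[LHS]/(x - Q x) => /eqP; rewrite subr_eq0 => /eqP xE; exists x.
exact: closed_ker.
Qed.

Lemma range_projection : exists P, [/\ self_adjoint P,
  forall x, P (Q x) = Q x & forall x, Q (P x) = P x].
Proof.
have [P [sP PM PE]] := orthogonal_projection_op
  (CSubspace (linear_set_range Q) closed_range_idempotent).
exists P; split=> // x; first by apply: PE; exists x.
by have [y _ <-] := PM x; exact: idempotentE.
Qed.

(* The operator Q Q* + (1 - P), with P the projection onto the range of Q, is
   bounded below by 1: on the range of Q, |Q* x| >= |x|. *)
Lemma range_projection_ge1 P : self_adjoint P ->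
  (forall x, P (Q x) = Q x) -> (forall x, Q (P x) = P x) ->
  forall x, hn x ^+ 2 <= Re (inner (Q (Q' x) + (x - P x)) x).
Proof.
move=> sP PQ QP x.
have PP y : P (P y) = P y by rewrite -[P y]QP PQ.
have Q'P y : Q' (P y) = Q' y.
  by apply: inner_ext => z; rewrite !adjBP' sP PQ.
have -> : inner (Q (Q' x) + (x - P x)) x =
    inner (Q' x) (Q' x) + inner (x - P x) (x - P x).
  rewrite linearDl/= adjBP; congr (_ + _).
  by rewrite linearBr/= [inner _ (P x)]linearBl/= -!sP PP subrr subr0.
have -> : hn x ^+ 2 = hn (x - P x) ^+ 2 + hn (P x) ^+ 2.
  by rewrite -pythagoras ?subrK// linearBl/= [inner (P x) _]sP PP subrr.
rewrite raddfD/= -!hn_sqr_Re addrC lerD2r ler_pXn2r ?nnegrE ?hn_ge0// -Q'P.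
have := Re_cauchy_schwarz (Q' (P x)) (P x); rewrite adjBP' QP -hn_sqr_Re.
have := hn_ge0 (P x); have := hn_ge0 (Q' (P x)).
by move: (hn _) (hn (P x)) => a b a0 b0 ba; rewrite leNgt; apply/negP; nra.
Qed.

Let S := absB Q'.

(** Let T be a square root of Q Q* + (1 - P). It commutes with P because P commutes with that
    operator, so T P is positive with square Q Q*. *)
Lemma absB_adj_spec : positiveB S /\ forall x, S (S x) = Q (Q' x).
Proof.
suff [S0 S00 S0E] : exists2 S0, positiveB S0 & S0 \oB S0 = adjB Q' \oB Q'.
  have [] := @xgetPex _ 0 [set S0 : 'B(H, H) | positiveB S0 /\
    S0 \oB S0 = adjB Q' \oB Q'] (ex_intro _ S0 (conj S00 S0E)).
  move=> H1 H2; split=> [|x]; first exact: H1.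
  have -> : Q (Q' x) = adjB Q' (Q' x) by rewrite adjBK.
  exact: (bop_congr H2).
have [P [sP PQ QP]] := range_projection.
have PP y : P (P y) = P y by rewrite -[P y]QP PQ.
have Q'P y : Q' (P y) = Q' y.
  by apply: inner_ext => z; rewrite !adjBP' sP PQ.
have [||T [T0 TT Tcomm]] := @ge1_sqrtB_exists (Q \oB Q' + (bid H - P)).
- move=> x y; rewrite -[LHS]/(inner (Q (Q' x) + (x - P x)) y).
  rewrite -[RHS]/(inner x (Q (Q' y) + (y - P y))).
  rewrite linearDl linearDr/= linearBl linearBr/= sP; congr (_ + _).
  by rewrite adjBP adjBP'.
- exact: range_projection_ge1.
have PT x : P (T x) = T (P x).
  apply: Tcomm => y.
  rewrite -[LHS]/(P (Q (Q' y) + (y - P y))) -[RHS]/(Q (Q' (P y)) + (P y - P (P y))).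
  by rewrite linearD/= linearB/= PP subrr PQ Q'P.
exists (T \oB P).
  move=> x; rewrite -[X in inner X _]/(T (P x)) -[P x]PP -PT sP; exact: T0.
apply: bop_ext => x; rewrite -[LHS]/(T (P (T (P x)))) PT TT PP.
rewrite -[LHS]/(Q (Q' (P x)) + (P x - P (P x))) PP subrr addr0 Q'P.
by rewrite -[RHS]/(adjB Q' (Q' x)) adjBK.
Qed.

Let sS : self_adjoint S. Proof. exact/self_adjoint_positiveB/absB_adj_spec.1. Qed.
Let SS x : S (S x) = Q (Q' x). Proof. exact: absB_adj_spec.2. Qed.

(** As |S y|^2 = <Q Q' y, y>, [S] kills whatever [Q'] kills, in particular Q' x - x. *)
Lemma absB_adj_idempotent x : S (Q' x) = S x.
Proof.
apply/eqP; rewrite -subr_eq0 -linearB; apply/eqP/inner_self_eq0.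
have Q'0 : Q' (Q' x - x) = 0 by rewrite linearB/= adj_idempotentE subrr.
by rewrite sS SS Q'0 linear0 linear0r.
Qed.

Lemma idempotent_absB_adj x : Q (S x) = S x.
Proof. by apply: inner_ext => y; rewrite adjBP sS absB_adj_idempotent -sS. Qed.

(** T = S + (1 - P) satisfies T^2 = Q Q* + (1 - P) >= 1, hence has an inverse B. Then B P is the
    Moore-Penrose inverse, both products with S being P. *)
Lemma pinvB_absB_adj_spec : let X := pinvB S in
  [/\ S \oB X \oB S = S, X \oB S \oB X = X,
      adjB (S \oB X) = S \oB X & adjB (X \oB S) = X \oB S].
Proof.
suff [X XP] : exists X, [/\ S \oB X \oB S = S, X \oB S \oB X = X,
      adjB (S \oB X) = S \oB X & adjB (X \oB S) = X \oB S].
  exact: (@xgetPex _ 0 [set X : 'B(H, H) | [/\ S \oB X \oB S = S,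
    X \oB S \oB X = X, adjB (S \oB X) = S \oB X &
    adjB (X \oB S) = X \oB S]] (ex_intro _ X XP)).
have [P [sP PQ QP]] := range_projection.
have PP y : P (P y) = P y by rewrite -[P y]QP PQ.
have PS x : P (S x) = S x by rewrite -idempotent_absB_adj PQ.
have SP x : S (P x) = S x by apply: inner_ext => y; rewrite sS sP PS -sS.
pose T := S + (bid H - P).
have TE x : T x = S x + (x - P x) by [].
have sT : self_adjoint T.
  by move=> x y; rewrite !TE linearDl linearDr/= linearBl linearBr/= sS sP.
have [||B [BT TB]] := @self_adjoint_bounded_below_inverse _ _ T 1 sT.
- exact: ltr01.
- move=> x; rewrite mul1r -(@ler_pXn2r _ 2)// ?nnegrE ?hn_ge0//.
  rewrite hn_self_adjoint_sqr//.
  have -> : T (T x) = Q (Q' x) + (x - P x).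
    by rewrite !TE linearD/= linearB/= SP subrr addr0 SS linearD/= linearB/= PP
      PS subrr addr0 [S x + _]addrC addrK.
  exact: range_projection_ge1.
have TP x : T (P x) = S x by rewrite TE PP subrr addr0 SP.
have PT x : P (T x) = S x by rewrite TE linearD/= linearB/= PP subrr addr0 PS.
have BS x : B (S x) = P x by rewrite -TP BT.
have SB x : S (B x) = P x by rewrite -PT TB.
have PB x : P (B x) = B (P x) by rewrite -BS SB.
have SX x : (S \oB (B \oB P)) x = P x by rewrite -[LHS]/(S (B (P x))) SB PP.
have XS x : ((B \oB P) \oB S) x = P x by rewrite -[LHS]/(B (P (S x))) PS BS.
exists (B \oB P); split.
- apply: bop_ext => x; rewrite -[LHS]/((S \oB (B \oB P)) (S x)) SX; exact: PS.
- apply: bop_ext => x; rewrite -[LHS]/(((B \oB P) \oB S) ((B \oB P) x)) XS.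
  by rewrite -[LHS]/(P (B (P x))) PB PP.
- by apply: self_adjoint_adjB => x y; rewrite !SX sP.
- by apply: self_adjoint_adjB => x y; rewrite !XS sP.
Qed.

Lemma invB_absB_adj_spec : let Z := invB (S + bid H) in
  Z \oB (S + bid H) = bid H /\ (S + bid H) \oB Z = bid H.
Proof.
have [Z [SZ ZS]] := add1_inverse absB_adj_spec.1.
exact: (@xgetPex _ 0 [set Z : 'B(H, H) | Z \oB (S + bid H) = bid H /\
  (S + bid H) \oB Z = bid H] (ex_intro _ Z (conj ZS SZ))).
Qed.

Let X := pinvB S.
Let Z := invB (S + bid H).
Let m := matched_proj Q.
Let G := S + Q'.

(* X, the Moore-Penrose inverse of the self-adjoint S, commutes with S: both
   S X and X S are self-adjoint, so each fixes S on the left and on the right. *)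
Let E_spec : [/\ forall x, S (X x) = X (S x), self_adjoint X,
  forall x, S (X (S x)) = S x & forall x, X (S (X x)) = X x].
Proof.
have [h1 h2 /adjB_self_adjoint h3 /adjB_self_adjoint h4] := pinvB_absB_adj_spec.
have SXS x : S (X (S x)) = S x by rewrite -[LHS]/((S \oB X \oB S) x) h1.
have XSX x : X (S (X x)) = X x by rewrite -[LHS]/((X \oB S \oB X) x) h2.
have sE x y : inner (S (X x)) y = inner x (S (X y)) := h3 x y.
have sF x y : inner (X (S x)) y = inner x (X (S y)) := h4 x y.
have SE x : S (S (X x)) = S x.
  by apply: inner_ext => y; rewrite sS sE SXS -sS.
have FS x : X (S (S x)) = S x.
  by apply: inner_ext => y; rewrite sF sS SXS -sS.
have EF x : S (X x) = X (S x).
  by rewrite -FS SE.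
split=> // x y.
have XE z : S (X (X z)) = X z by rewrite EF XSX.
by rewrite -[X x]XE sE -sS sE XE.
Qed.

Let EF x : S (X x) = X (S x). Proof. by case: E_spec. Qed.
Let sX : self_adjoint X. Proof. by case: E_spec. Qed.
Let SXS x : S (X (S x)) = S x. Proof. by case: E_spec. Qed.

Let SZ x : S (Z x) + Z x = x.
Proof. exact: (bop_congr invB_absB_adj_spec.2). Qed.

Let ZS x : Z (S x) + Z x = x.
Proof.
by rewrite -linearD; exact: (bop_congr invB_absB_adj_spec.1).
Qed.

Let sZ : self_adjoint Z.
Proof.
move=> x y; rewrite -{1}(SZ y) linearDr/= -sS -linearDl/=.
by rewrite SZ.
Qed.

Let XZ x : X (Z x) = Z (X x).
Proof.
rewrite -[LHS]ZS -[Z _ + Z _]linearD/= EF.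
by rewrite -[X _ + X _]linearD/= SZ.
Qed.

(** S kills S (X x) - x, and Q Q' = S^2 lets [Q'] kill whatever S kills. *)
Let Q'E x : Q' (S (X x)) = Q' x.
Proof.
apply/eqP; rewrite -subr_eq0 -linearB; apply/eqP/inner_self_eq0.
rewrite adjBP' -SS.
have -> : S (S (X x) - x) = 0 by rewrite linearB/= EF SXS subrr.
by rewrite linear0 linear0r.
Qed.

Let EQ x : S (X (Q x)) = Q x.
Proof. by apply: inner_ext => y; rewrite sS sX -EF adjBP Q'E -adjBP. Qed.

Let mE x : m x = 2^-1 *: G (X (Z (S x + Q x))).
Proof. by []. Qed.

Let GE x : G x = S x + Q' x. Proof. by []. Qed.

Let sGm x y : inner (S x + Q x) y = inner x (G y).
Proof. by rewrite GE linearDl linearDr/= sS adjBP. Qed.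

(** m = G X Z G* / 2, where X and Z are self-adjoint and commute. *)
Lemma matched_proj_self_adjoint : self_adjoint m.
Proof.
move=> x y; rewrite !mE linearZl_LR linearZr_LR/=.
have -> : (2^-1 : R[i])^* = 2^-1 by rewrite fmorphV/= rmorph_nat.
congr (_ * _).
by rewrite -sGm innerC -sGm -innerC sX sZ -XZ.
Qed.

(** Q G = S + S^2 = S (S + 1): Z cancels S + 1, and the remaining S X fixes the ranges of S and
    Q. *)
Lemma idempotent_matched_proj x : Q (m x) = 2^-1 *: (S x + Q x).
Proof.
rewrite mE linearZ/=; congr (_ *: _); rewrite linearD/= idempotent_absB_adj -SS.
rewrite -[X in X = _]linearD/= XZ [_ + S _]addrC SZ.
by rewrite [X (_ + _)]linearD/= linearD/= SXS EQ.
Qed.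

Lemma matched_proj_adjoint x : m (Q' x) = 2^-1 *: (S x + Q' x).
Proof.
apply: inner_ext => y; rewrite matched_proj_self_adjoint adjBP'.
rewrite idempotent_matched_proj linearZr_LR linearZl_LR/=.
have -> : (2^-1 : R[i])^* = 2^-1 by rewrite fmorphV/= rmorph_nat.
by rewrite linearDl linearDr/= sS adjBP'.
Qed.

(** It suffices that m fixes the range of G. Here G* G = 2 (S^2 + S), so m G = G X S, and X S is
    absorbed by both S and Q'. *)
Lemma matched_proj_idempotent x : m (m x) = m x.
Proof.
have mZ (a : R[i]) (y : H) : m (a *: y) = a *: m y by rewrite linearZ.
suff mG u : m (G u) = G u by rewrite [in LHS](mE x) mZ mG.
rewrite mE.
have -> : S (G u) + Q (G u) = 2%:R *: (S (S u) + S u).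
  rewrite scaler_nat mulr2n GE [S (_ + _)]linearD [Q (_ + _)]linearD/=.
  by rewrite absB_adj_idempotent idempotent_absB_adj -SS [S u + _]addrC.
have GZ (a : R[i]) (y : H) : G (a *: y) = a *: G y by rewrite linearZ.
have -> : X (Z (2%:R *: (S (S u) + S u))) = 2%:R *: X (S u).
  by rewrite [Z _]linearZ/= [X _]linearZ/= [Z (_ + _)]linearD/= ZS.
rewrite GZ scalerA mulVf ?pnatr_eq0// scale1r.
by rewrite !GE SXS -EF Q'E.
Qed.

(* With J = 2 m(Q) - 1 this and the next lemma read Q J = |Q*| = J Q*. *)
Lemma idempotent_reflection x : Q (2%:R *: m x - x) = S x.
Proof.
rewrite linearB/= linearZ/= idempotent_matched_proj scalerA divff ?pnatr_eq0//.
by rewrite scale1r addrK.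
Qed.

Lemma reflection_adjoint x : 2%:R *: m (Q' x) - Q' x = S x.
Proof.
by rewrite matched_proj_adjoint scalerA divff ?pnatr_eq0// scale1r addrK.
Qed.

(** Such an x lies in the range of G, while S x = Q (2 m x - x) = Q x = 0 gives G* x = 0. *)
Lemma matched_proj_range_ker x : m x = x -> Q x = 0 -> x = 0.
Proof.
move=> mx Qx; apply: inner_self_eq0.
rewrite -{2}mx mE linearZr_LR/= -sGm Qx addr0.
have := idempotent_reflection x; rewrite mx scaler_nat mulr2n addrK Qx => <-.
by rewrite linear0l mulr0.
Qed.

(** Here S x = Q (- x) = - x, which positivity of S allows only for x = 0. *)
Lemma matched_proj_ker_range x : m x = 0 -> Q x = x -> x = 0.
Proof.
move=> mx Qx; apply: hn_eq0; apply/eqP.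
have := idempotent_reflection x; rewrite mx scaler0 sub0r linearN/= Qx => Sx.
have := absB_adj_spec.1 x; rewrite -Sx linearNl/= oppr_ge0 hn_sqr.
rewrite lecR => le0; have := sqr_ge0 (hn x) => ge0.
by rewrite -sqrf_eq0 eq_le le0.
Qed.

End Idempotent.

End MatchedProjectionTheory.
(** * The canonical decomposition *)

Section CanonicalDecomposition.
Context {R : realType} {H : hilbertType R}.

Lemma projB_uniq (M : csubspace H) x (q : subsp M) :
  (forall z : subsp M, inner (x - val q) (val z) = 0) -> projB M x = q.
Proof.
move=> qP; apply: inner_ext => z; apply/eqP; rewrite -subr_eq0; apply/eqP.
have E : val (projB M x) - val q = (x - val q) - (x - val (projB M x)).
  by rewrite opprB [RHS]addrC addrA subrK.
rewrite -[LHS]/(inner (val (projB M x)) (val z) - inner (val q) (val z)).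
by rewrite -linearBl/= E linearBl/= qP projBP subrr.
Qed.

Lemma inner_projB (M : csubspace H) x (z : subsp M) :
  inner (projB M x) z = inner x (val z).
Proof.
apply/esym/eqP; rewrite -subr_eq0; apply/eqP.
by rewrite -[RHS](projBP x z) linearBl.
Qed.

Lemma cs_set_val (M : csubspace H) (z : subsp M) : cs_set M (val z).
Proof. by case: z => z /= /asboolP. Qed.

Lemma closure_subset_closed (A B : set H) :
  closed B -> A `<=` B -> closure A `<=` B.
Proof. by move=> cB AB x Ax; apply: cB; exact: closure_subset AB _ Ax. Qed.

Lemma closure_orthogonal (A : set H) y :
  (forall x, A x -> inner x y = 0) -> forall x, closure A x -> inner x y = 0.
Proof.
move=> Ay; apply: (@closure_subset_closed A [set x | inner x y = 0]) => //.
pose f (x : H) : R[i]^o := inner x y.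
have -> : [set x | inner x y = 0] = f @^-1` [set 0] by [].
move/continuous_closedP : (@continuous_innerl _ _ y); apply.
exact/accessible_closed_set1/hausdorff_accessible/norm_hausdorff.
Qed.

Variables (Q : 'B(H, H)) (Qidem : idempotentB Q).
Local Notation m := (matched_proj Q).
Local Notation Q' := (adjB Q).
Let sm : self_adjoint m := matched_proj_self_adjoint Qidem.
Let mm : forall x, m (m x) = m x := matched_proj_idempotent Qidem.

Let reflE x : Q (2%:R *: m x - x) = 2%:R *: m (Q' x) - Q' x.
Proof. by rewrite idempotent_reflection// reflection_adjoint. Qed.

Let sub_m0 x : m (x - m x) = 0.
Proof. by rewrite bopB mm subrr. Qed.

(** On the range of m, [reflE] says Q x = J (Q' x) with J = 2 m - 1. As J fixes the range of m, Q' x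
    and Q x lie in that range together. *)
Let range_adjoint x : m x = x -> Q' x = m (Q' x) -> Q x = m (Q x).
Proof.
move=> mx Q'x; have := reflE x.
by rewrite mx -Q'x !scaler_nat !mulr2n !addrK => ->.
Qed.

Let range_adjoint' x : m x = x -> Q x = m (Q x) -> Q' x = m (Q' x).
Proof.
move=> mx Qx; have := reflE x.
rewrite mx scaler_nat mulr2n addrK => E.
have : m (Q x) = m (Q' x) by rewrite E bopB bopZ mm scaler_nat mulr2n addrK.
rewrite -Qx => h; move: E; rewrite -h scaler_nat mulr2n => E.
by rewrite -[LHS](subKr (Q x + Q x)) -E addrK.
Qed.

Let ker_adjoint x : m x = 0 -> m (Q' x) = - m (Q x).
Proof.
move=> mx; have := congr1 m (reflE x); rewrite mx scaler0 sub0r !bopN.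
by rewrite bopB bopZ mm scaler_nat mulr2n addrK => <-.
Qed.

Let Hsub1E x : cs_set (Hsub1 Q) x <-> m x = x /\ Q x = x.
Proof.
split; last first.
  by move=> [mx Qx]; apply: subset_closure; split; exists x.
have fix_closure (T : 'B(H, H)) : (forall y, T (T y) = T y) ->
    closure (range T) `<=` [set y | T y = y].
  move=> TT; have -> : [set y | T y = y] = kerB (bid H - T).
    apply/seteqP; split=> y Ty.
      by rewrite /kerB /= -[LHS]/(y - T y) Ty subrr.
    by apply/esym/eqP; rewrite -subr_eq0; apply/eqP; exact: Ty.
  apply: (closure_subset_closed (closed_ker _)) => _ [y _ <-].
  by rewrite /kerB /= -[LHS]/(T y - T (T y)) TT subrr.
move=> H1x; split.
  by apply: (fix_closure m) => //; apply: closureS H1x => y [].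
by apply: (fix_closure Q) => [y|]; [exact: idempotentE|apply: closureS H1x => y []].
Qed.

Let Hsub5_m x : cs_set (Hsub5 Q) x -> m x = x.
Proof.
have cl : closed (kerB (bid H - m)) by exact: closed_ker.
suff : closure (range (m \oB Q \oB (bid H - m))) `<=` kerB (bid H - m).
  move=> s /s; rewrite /kerB /= -[X in X = _]/(x - m x) => /eqP.
  by rewrite subr_eq0 => /eqP.
apply: closure_subset_closed => // _ [y _ <-]; rewrite /kerB /=.
rewrite -[LHS]/(m (Q (y - m y)) - m (m (Q (y - m y)))).
by rewrite mm subrr.
Qed.

Let Hsub6_m x : cs_set (Hsub6 Q) x -> m x = 0.
Proof.
apply: (closure_subset_closed (closed_ker m)).
move=> _ [y _ <-]; rewrite /kerB /= -[LHS]/(m (Q (m y) - m (Q (m y)))).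
exact: sub_m0.
Qed.

Let Hsub4E x : cs_set (Hsub4 Q) x <-> m x = 0 /\ Q x = 0.
Proof. by []. Qed.

(** Q x = x lies in the range of m, hence so does Q' x, which is thus orthogonal to every y - m
    y. *)
Let Hsub15 x y : cs_set (Hsub1 Q) x -> cs_set (Hsub5 Q) y -> inner x y = 0.
Proof.
move=> /Hsub1E[mx Qx] H5y; apply: inner_eq0_sym.
move: y H5y; apply: closure_orthogonal => _ [y _ <-].
rewrite -[LHS]/(inner (m (Q (y - m y))) x) sm mx adjBP.
rewrite linearBl/= sm -range_adjoint'// ?Qx ?mx//.
by rewrite subrr.
Qed.

Let Hsub46 x y : cs_set (Hsub4 Q) x -> cs_set (Hsub6 Q) y -> inner x y = 0.
Proof.
move=> /Hsub4E[mx Qx] H6y; apply: inner_eq0_sym.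
move: y H6y; apply: closure_orthogonal => _ [y _ <-].
rewrite -[LHS]/(inner (Q (m y) - m (Q (m y))) x).
rewrite linearBl/= sm mx linear0r subr0 adjBP sm ker_adjoint// Qx linear0.
by rewrite oppr0 linear0r.
Qed.

Let m_orthogonal x y : m x = x -> m y = 0 -> inner x y = 0.
Proof. by move=> mx my; rewrite -mx sm my linear0r. Qed.

(** Orthogonality to H5 puts Q' x, hence Q x, in the range of m. Then Q x - x lies in R(m) and N(Q),
    so it vanishes. *)
Lemma Hsub1_max x : m x = x -> (forall y, cs_set (Hsub5 Q) y -> inner x y = 0) ->
  cs_set (Hsub1 Q) x.
Proof.
move=> mx x5.
have Q'x : Q' x = m (Q' x).
  apply/eqP; rewrite -subr_eq0; apply/eqP; apply: inner_ext => y; rewrite linear0l.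
  have : inner x (m (Q (y - m y))) = 0.
    by apply: x5; apply: subset_closure; exists y.
  by rewrite -sm mx -adjBP' linearBr linearBl/= -sm.
have Qx := range_adjoint mx Q'x.
apply/Hsub1E; split => //; apply/eqP; rewrite -subr_eq0; apply/eqP.
apply: (matched_proj_range_ker Qidem); rewrite bopB; last first.
  by rewrite idempotentE// subrr.
by rewrite -Qx mx.
Qed.

(** Orthogonality to H6 gives m (Q' x) = 0, hence m (Q x) = 0. Then Q x lies in N(m) and R(Q), so it
    vanishes. *)
Lemma Hsub4_max x : m x = 0 -> (forall y, cs_set (Hsub6 Q) y -> inner x y = 0) ->
  cs_set (Hsub4 Q) x.
Proof.
move=> mx x6; apply/Hsub4E; split => //.
apply: (matched_proj_ker_range Qidem); last exact: idempotentE.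
apply: inner_ext => y; rewrite linear0l.
apply/eqP; rewrite -oppr_eq0 -linearNl/= -ker_adjoint//; apply/eqP.
have : inner x (Q (m y) - m (Q (m y))) = 0.
  by apply: x6; apply: subset_closure; exists y.
by rewrite linearBr/= -[inner x (m _)]sm mx linear0l subr0 -adjBP' -sm.
Qed.

Let P1 x := val (projB (Hsub1 Q) x).
Let P4 x := val (projB (Hsub4 Q) x).
Let P5 x := val (projB (Hsub5 Q) x).
Let P6 x := val (projB (Hsub6 Q) x).

Let val1E (a : Hcan1 Q) : m (val a) = val a.
Proof. by have /Hsub1E[] := cs_set_val a. Qed.
Let val4E (b : Hcan4 Q) : m (val b) = 0.
Proof. by have /Hsub4E[] := cs_set_val b. Qed.
Let val5E (c : Hcan5 Q) : m (val c) = val c.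
Proof. exact: Hsub5_m (cs_set_val c). Qed.
Let val6E (d : Hcan6 Q) : m (val d) = 0.
Proof. exact: Hsub6_m (cs_set_val d). Qed.

Lemma matched_projE x : m x = P1 x + P5 x.
Proof.
apply/eqP; rewrite -subr_eq0; apply/eqP; set w := _ - _.
have mw : m w = w by rewrite /w bopB bopD mm val1E val5E.
have w5 y : cs_set (Hsub5 Q) y -> inner w y = 0.
  move=> H5y; rewrite /w opprD addrCA linearDl linearNl/=.
  rewrite Hsub15//; last exact: cs_set_val.
  have /asboolP My := H5y.
  rewrite oppr0 add0r linearBl/= sm (Hsub5_m H5y) -linearBl.
  exact: (projBP x (SubSp My)).
(* w is now in H1; being also orthogonal to H1, it is 0. *)
have H1w := Hsub1_max mw w5; apply: inner_self_eq0.
rewrite {1}/w opprD addrA linearDl linearNl/= [X in _ - X]inner_eq0_sym; last first.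
  by apply: Hsub15 => //; exact: cs_set_val.
have /asboolP Mw := H1w.
rewrite subr0 linearBl/= sm mw -linearBl; exact: (projBP x (SubSp Mw)).
Qed.

Lemma matched_proj_complE x : x - m x = P4 x + P6 x.
Proof.
apply/eqP; rewrite -subr_eq0; apply/eqP; set w := _ - _.
have mw : m w = 0 by rewrite /w bopB sub_m0 bopD val4E val6E addr0 subr0.
have w6 y : cs_set (Hsub6 Q) y -> inner w y = 0.
  move=> H6y; rewrite /w opprD addrCA linearDl linearNl/=.
  rewrite Hsub46//; last exact: cs_set_val.
  have /asboolP My := H6y.
  rewrite oppr0 add0r addrAC linearBl/= sm (Hsub6_m H6y) linear0r subr0.
  exact: (projBP x (SubSp My)).
have H4w := Hsub4_max mw w6; apply: inner_self_eq0.
rewrite {1}/w opprD addrA linearDl linearNl/= [X in _ - X]inner_eq0_sym; last first.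
  by apply: Hsub46 => //; exact: cs_set_val.
have /asboolP Mw := H4w.
rewrite subr0 addrAC linearBl/= sm mw linear0r subr0.
exact: (projBP x (SubSp Mw)).
Qed.

Let W := U_mQ Q.

Lemma adjB_U_mQ a b c d :
  adjB W (a, (b, (c, d))) = val a + val b + val c + val d.
Proof.
apply: inner_ext => x; rewrite innerC -adjBP -innerC.
rewrite -[LHS]/(inner a (projB _ x) + (inner b (projB _ x) +
  (inner c (projB _ x) + inner d (projB _ x)))).
by rewrite ![inner _ (projB _ x)]innerC !inner_projB -!innerC !linearDl/= !addrA.
Qed.

Lemma adjB_U_mQK x : adjB W (W x) = x.
Proof.
rewrite -[W x]/(projB (Hsub1 Q) x, (projB (Hsub4 Q) x,
  (projB (Hsub5 Q) x, projB (Hsub6 Q) x))).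
rewrite adjB_U_mQ -/(P1 x) -/(P4 x) -/(P5 x) -/(P6 x) [P1 x + _ + _]addrAC.
by rewrite -matched_projE -addrA -matched_proj_complE addrC subrK.
Qed.

Lemma U_mQK z : W (adjB W z) = z.
Proof.
case: z => a [b [c d]]; rewrite adjB_U_mQ.
have o14 (a1 : Hcan1 Q) (b1 : Hcan4 Q) : inner (val a1) (val b1) = 0.
  by apply: m_orthogonal; rewrite ?val1E ?val4E.
have o15 (a1 : Hcan1 Q) (c1 : Hcan5 Q) : inner (val a1) (val c1) = 0.
  by apply: Hsub15; exact: cs_set_val.
have o16 (a1 : Hcan1 Q) (d1 : Hcan6 Q) : inner (val a1) (val d1) = 0.
  by apply: m_orthogonal; rewrite ?val1E ?val6E.
have o54 (c1 : Hcan5 Q) (b1 : Hcan4 Q) : inner (val c1) (val b1) = 0.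
  by apply: m_orthogonal; rewrite ?val5E ?val4E.
have o46 (b1 : Hcan4 Q) (d1 : Hcan6 Q) : inner (val b1) (val d1) = 0.
  by apply: Hsub46; exact: cs_set_val.
have o56 (c1 : Hcan5 Q) (d1 : Hcan6 Q) : inner (val c1) (val d1) = 0.
  by apply: m_orthogonal; rewrite ?val5E ?val6E.
have o41 b' a' := inner_eq0_sym (o14 a' b').
have o51 c' a' := inner_eq0_sym (o15 a' c').
have o61 d' a' := inner_eq0_sym (o16 a' d').
have o45 b' c' := inner_eq0_sym (o54 c' b').
have o64 d' b' := inner_eq0_sym (o46 b' d').
have o65 d' c' := inner_eq0_sym (o56 c' d').
rewrite -[LHS]/(projB (Hsub1 Q) _, (projB (Hsub4 Q) _,
  (projB (Hsub5 Q) _, projB (Hsub6 Q) _))).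
congr (_, (_, (_, _))); apply: projB_uniq => z; rewrite linearBl !linearDl/=.
- by rewrite o41 o51 o61 !addr0 subrr.
- by rewrite o14 o54 o64 add0r !addr0 subrr.
- by rewrite o15 o45 o65 !add0r addr0 subrr.
- by rewrite o16 o46 o56 !add0r subrr.
Qed.

Lemma matched_proj_U_mQ a b c d :
  m (adjB W (a, (b, (c, d)))) = adjB W (a, (0, (c, 0))).
Proof.
rewrite !adjB_U_mQ !bopD val1E val4E val5E val6E.
by rewrite [in RHS]raddf0 !addr0.
Qed.

End CanonicalDecomposition.

(** * The numerical range of [T_op Q] in canonical coordinates *)

Section NumericalRangeReduction.
Context {R : realType} {H : hilbertType R}.
Variables (Q : 'B(H, H)) (Qidem : idempotentB Q).
Variables (U : 'B(Hcan5 Q, Hcan6 Q)) (D : 'B(Hcan5 Q, Hcan5 Q)).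
Hypothesis QUD : canonical_decomposition U D.

Let W := U_mQ Q.

Let QE a b c d : W (Q (adjB W (a, (b, (c, d))))) =
  (a, (0, (D c - ell D (adjB U d),
    U (ell D c) + U (adjB U d - D (adjB U d))))).
Proof.
case: QUD => _ _ _ /bop_congr E; apply: etrans (E (a, (b, (c, d)))) _.
rewrite -[LHS]/(a + 0, (0 + (0 + 0), (0 + (0 + (D c - ell D (adjB U d))),
    0 + (0 + (U (ell D c) + U (adjB U d - D (adjB U d))))))).
by rewrite !add0r addr0.
Qed.

Let matched_W a b c d :
  matched_proj Q (adjB W (a, (b, (c, d)))) = adjB W (a, (0, (c, 0))).
Proof. exact: matched_proj_U_mQ. Qed.

(** Moving the self-adjoint m onto x leaves only the H1 and H5 coordinates. [adjB U d] transports
    the H6 coordinate to H5, as in V_Q. *)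
Lemma inner_T_op a b c d : let x := adjB W (a, (b, (c, d))) in
  inner (T_op Q x) x = inner a a *+ 2 +
    inner (T_tilde D (c, adjB U d)) ((c, adjB U d) : hsum _ _).
Proof.
move=> x.
have -> : T_op Q x = matched_proj Q x + matched_proj Q (Q x) by [].
have mx : matched_proj Q x = adjB W (a, (0, (c, 0))) by exact: matched_W.
have -> : inner (matched_proj Q x + matched_proj Q (Q x)) x =
    inner a a + inner c c + (inner a a + inner (D c - ell D (adjB U d)) c).
  rewrite innerDl; congr (_ + _).
    rewrite mx adjBP' U_mQK//.
    rewrite -[LHS]/(inner a a + (inner 0 b + (inner c c + inner 0 d))).
    by rewrite !linear0l add0r addr0.
  rewrite (matched_proj_self_adjoint Qidem (Q x)) mx -adjBP QE.
  rewrite -[LHS]/(inner a a + (inner 0 (0 : Hcan4 Q) +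
    (inner (D c - ell D (adjB U d)) c + inner _ (0 : Hcan6 Q)))).
  by rewrite !linear0r add0r addr0.
rewrite -[inner (T_tilde D _) _]/(inner (D c + c - ell D (adjB U d)) c +
  inner (0 + 0) (adjB U d)).
by rewrite addr0 linear0l addr0 !linearBl linearDl/=; ring.
Qed.

Lemma hn_U_mQ_adj a b c d : hn (adjB W (a, (b, (c, d)))) ^+ 2 =
  hn a ^+ 2 + hn b ^+ 2 + hn ((c, adjB U d) : hsum _ _) ^+ 2.
Proof.
have [[_ UU] _ _ _] := QUD.
rewrite !hn_sqr_Re adjBP' U_mQK//.
have -> : inner ((c, adjB U d) : hsum _ _) (c, adjB U d) = inner c c + inner d d.
  rewrite -[LHS]/(inner c c + inner (adjB U d) (adjB U d)); congr (_ + _).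
  by rewrite adjBP'; congr (inner d _); exact: (bop_congr UU d).
rewrite -[X in Re X = _]/(inner a a + (inner b b + (inner c c + inner d d))).
by rewrite !raddfD/= !addrA.
Qed.

(** If H5 = 0, then H6 = 0 through the unitary U, so Q is 1 on H1 and 0 on H4, that is, Q = m. *)
Lemma Hcan5_neq0 : ~ projectionB Q -> exists c : Hcan5 Q, c != 0.
Proof.
move=> nQ; apply: contrapT => nc; apply: nQ.
have c0 (c : Hcan5 Q) : c = 0.
  by apply/eqP; apply: contra_notT nc => c0; exists c.
have [[_ UU] _ _ _] := QUD.
have d0 (d : Hcan6 Q) : d = 0.
  by rewrite -[LHS](bop_congr UU d) -[LHS]/(U (adjB U d)) [adjB U d]c0 bop0.
suff -> : Q = matched_proj Q.
  split; last exact/self_adjoint_adjB/matched_proj_self_adjoint.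
  by apply: bop_ext => x; exact: matched_proj_idempotent.
apply: bop_ext => x; rewrite -(adjB_U_mQK Qidem x) -/W.
case: (W x) => a [b [c d]]; rewrite matched_W.
rewrite -[LHS](adjB_U_mQK Qidem) -/W QE; congr (adjB W _).
by congr (_, (_, (_, _))); [exact: etrans (c0 _) (esym (c0 _)) | exact: d0].
Qed.

Lemma numrange_T_op : numrange (T_op Q) =
  [set w | exists (a : Hcan1 Q) (b : Hcan4 Q) (y : hsum (Hcan5 Q) (Hcan5 Q)),
    hn a ^+ 2 + hn b ^+ 2 + hn y ^+ 2 = 1 /\
    w = inner a a *+ 2 + inner (T_tilde D y) y].
Proof.
apply/seteqP; split=> [_ [x x1 <-]|_ [a [b [[c e] [n1 ->]]]]].
  move: x1; rewrite -(adjB_U_mQK Qidem x) -/W; case: (W x) => a [b [c d]] /= x1.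
  exists a, b, (c, adjB U d); split; last exact: inner_T_op.
  by rewrite -hn_U_mQ_adj /hn x1 expr1n.
have [[UU _] _ _ _] := QUD.
have Ue : adjB U (U e) = e := bop_congr UU e.
exists (adjB W (a, (b, (c, U e)))); last by rewrite inner_T_op Ue.
have /eqP : hn (adjB W (a, (b, (c, U e)))) ^+ 2 = 1 by rewrite hn_U_mQ_adj Ue.
by rewrite sqrp_eq1 ?hn_ge0// => /eqP n1'; rewrite /= hnE n1'.
Qed.

End NumericalRangeReduction.
(** * Convexity of the numerical range *)

Section PlaneConvexity.
Context {R : realType}.

Definition segment_convex (C : set R[i]) := forall (u v : R[i]) (t : R),
  C u -> C v -> 0 <= t <= 1 -> C (t%:C%C * u + (1 - t)%:C%C * v).

(** The missing weight 1 - s - t falls on 0: mix u and v in ratio s : t, then shrink towards 0 by s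
    + t. *)
Lemma segment_convex0_comb (C : set R[i]) u v (s t : R) : segment_convex C ->
  C 0 -> C u -> C v -> 0 <= s -> 0 <= t -> s + t <= 1 ->
  C (s%:C%C * u + t%:C%C * v).
Proof.
move=> cC C0 Cu Cv s0 t0 st1; have [st0|st_neq0] := eqVneq (s + t) 0.
  have -> : s = 0 by lra.
  have -> : t = 0 by lra.
  by rewrite !mul0r addr0.
have st_gt0 : 0 < s + t by rewrite lt_def st_neq0 addr_ge0.
have s01 : 0 <= s / (s + t) <= 1.
  by rewrite divr_ge0 ?(ltW st_gt0)//= ler_pdivrMr// mul1r lerDl.
have st01 : 0 <= s + t <= 1 by rewrite st1 ltW.
have := cC _ _ _ (cC _ _ _ Cu Cv s01) C0 st01.
rewrite mulr0 addr0 mulrDr !mulrA -!rmorphM/=.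
have -> : (s + t) * (s / (s + t)) = s by field.
by have -> : (s + t) * (1 - s / (s + t)) = t by field.
Qed.

Lemma segment_crossing (a b x : R) : b < x < a ->
  exists t, 0 <= t <= 1 /\ t * a + (1 - t) * b = x.
Proof.
move=> /andP[bx xa]; have ab : 0 < a - b by lra.
exists ((x - b) / (a - b)); split; last by field; rewrite gt_eqF.
by rewrite divr_ge0 ?(ltW ab)//=; [rewrite ler_pdivrMr// mul1r; lra | lra].
Qed.

Lemma Re_comb (t : R) (u v : R[i]) :
  Re (t%:C%C * u + (1 - t)%:C%C * v) = t * Re u + (1 - t) * Re v.
Proof. by case: u v => a b [c d] /=; rewrite !mul0r !subr0. Qed.

Lemma Im_comb (t : R) (u v : R[i]) :
  Im (t%:C%C * u + (1 - t)%:C%C * v) = t * Im u + (1 - t) * Im v.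
Proof. by case: u v => a b [c d] /=; rewrite !mul0r !addr0. Qed.

Lemma near_Re_Im (z w : R[i]) (d : R) : `|z - w| < d%:C%C ->
  `|Re z - Re w| < d /\ `|Im z - Im w| < d.
Proof.
case: z w => a b [x y] /=; rewrite normc_def ltcR/= => zd.
by split; apply: le_lt_trans zd;
  rewrite -sqrtr_sqr ler_wsqrtr// ?lerDl ?lerDr sqr_ge0.
Qed.

(* A convex set meeting the four open quadrants at p contains p: the segments
   joining the upper, resp. lower, pair of points cross the vertical line
   through p above, resp. below, p. *)
Lemma interior_closure_convex (C : set R[i]^o) :
  segment_convex C -> interior (closure C) `<=` C.
Proof.
move=> cC p /nbhs_ballP[e /= e0 eC].
have eR : (Re e)%:C%C = e by rewrite RRe_real// gtr0_real.
(* The corners p + (+-d, +-d) are at distance sqrt 2 * d < 4 d from p, and points of C closer than d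
   to them stay in the open quadrants. *)
have [d [d0 eE]] : exists d : R, 0 < d /\ Re e = 4 * d.
  by exists (Re e / 4); split; [rewrite divr_gt0// -ltcR eR | field].
have quadrant (s t : R) : `|s| = 1 -> `|t| = 1 -> exists z : R[i],
    [/\ C z, `|Re z - (Re p + s * d)| < d & `|Im z - (Im p + t * d)| < d].
  move=> s1 t1; pose q : R[i]^o := ((Re p + s * d) +i* (Im p + t * d))%C.
  have qC : closure C q.
    apply: eC; rewrite -ball_normE/= -eR /q; case: (p) => a b /=.
    rewrite normc_def ltcR/= !opprD !addrA !addrN !add0r !sqrrN !exprMn.
    rewrite -(real_normK (num_real s)) -(real_normK (num_real t)) s1 t1 expr1n !mul1r.
    have -> : Re e = Num.sqrt (Re e ^+ 2).
      by rewrite sqrtr_sqr gtr0_norm// -ltcR eR.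
    rewrite ltr_sqrt; last by rewrite exprn_gt0// -ltcR eR.
    by rewrite eE; nra.
  have [|z [Cz]] := qC (ball q d%:C%C); first by apply: nbhsx_ballx; rewrite ltcR.
  by rewrite -ball_normE/= distrC => /near_Re_Im[]; exists z.
have N1 : `|-1 : R| = 1 by rewrite normrN normr1.
have [z1 [C1 x1 y1]] := quadrant 1 1 (normr1 _) (normr1 _).
have [z2 [C2 x2 y2]] := quadrant (-1) 1 N1 (normr1 _).
have [z3 [C3 x3 y3]] := quadrant 1 (-1) (normr1 _) N1.
have [z4 [C4 x4 y4]] := quadrant (-1) (-1) N1 N1.
move: x1 y1 x2 y2 x3 y3 x4 y4; rewrite !ltr_norml.
do 8!move=> /andP[? ?].
have [|s [s01 sE]] := @segment_crossing (Re z1) (Re z2) (Re p); first by lra.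
have [|t [t01 tE]] := @segment_crossing (Re z3) (Re z4) (Re p); first by lra.
have Cu := cC _ _ _ C1 C2 s01; have Cv := cC _ _ _ C3 C4 t01.
set u := (X in C X) in Cu; set v := (X in C X) in Cv.
have uRe : Re u = Re p by rewrite Re_comb.
have vRe : Re v = Re p by rewrite Re_comb.
have uIm : Im p < Im u by rewrite Im_comb; move/andP: s01 => [? ?]; nra.
have vIm : Im v < Im p by rewrite Im_comb; move/andP: t01 => [? ?]; nra.
have [|r [r01 rE]] := @segment_crossing (Im u) (Im v) (Im p); first by lra.
have -> : p = r%:C%C * u + (1 - r)%:C%C * v.
  apply/eqP; rewrite eq_complex Re_comb Im_comb rE uRe vRe eqxx andbT.
  by apply/eqP; ring.
exact: cC.
Qed.

End PlaneConvexity.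

(** * The Toeplitz-Hausdorff theorem *)

Section ToeplitzHausdorff.
Context {R : realType}.

Lemma quadratic_ivt (a b c : R) : c <= 0 -> 0 <= a + b + c ->
  exists s, 0 <= s <= 1 /\ a * s ^+ 2 + b * s + c = 0.
Proof.
move=> c0 abc; pose p := a *: 'X^2 + b *: 'X + c%:P.
have pE s : p.[s] = a * s ^+ 2 + b * s + c by rewrite /p !hornerE.
have [|s s01 /rootP] := @poly_ivt R p 0 1 ler01.
  by rewrite !pE expr1n !mulr1 expr0n/= !mulr0 !add0r c0.
by rewrite pE; exists s.
Qed.

(** The vanishing of the imaginary part is one real linear equation in (Re w, Im w), so it has a
    nonzero solution. *)
Lemma real_phase (b c : R[i]) :
  exists w : R[i], w != 0 /\ exists k : R, w^* * b + w * c = k%:C%C.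
Proof.
have Im0 (w z1 z2 : R[i]) : Re w * (Im z1 + Im z2) = Im w * (Re z1 - Re z2) ->
    Im (w^* * z1 + w * z2) = 0.
  by case: w z1 z2 => w1 w2 [b1 b2] [c1 c2] /= wE; lra.
pose u := Re b - Re c; pose v := Im b + Im c.
pose w : R[i] := if (u == 0) && (v == 0) then 1 else (u +i* v)%C.
have wE : Re w * v = Im w * u.
  by rewrite /w; case: ifP => [/andP[/eqP -> /eqP ->]|_] /=; rewrite ?mulr0//; ring.
exists w; split.
  rewrite /w; case: ifPn => [_|]; first exact: oner_neq0.
  by rewrite eq_complex.
exists (Re (w^* * b + w * c)); apply/eqP; rewrite eq_complex/= eqxx/=.
exact/eqP/Im0.
Qed.

Context {H : hilbertType R}.
Implicit Types T : 'B(H, H).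

Lemma inner_comb T (s : R) (w : R[i]) x y :
  inner (T (s%:C%C *: x + w *: y)) (s%:C%C *: x + w *: y) =
  (s ^+ 2)%:C%C * inner (T x) x + w * w^* * inner (T y) y +
  s%:C%C * (w^* * inner (T x) y + w * inner (T y) x).
Proof.
rewrite bopD !bopZ linearDl !linearDr/= !linearZl_LR !linearZr_LR/= conj_real.
by rewrite rmorphXn/=; ring.
Qed.

Lemma numrangeZ T y : y != 0 ->
  exists2 w, numrange T w & inner (T y) y = (hn y ^+ 2)%:C%C * w.
Proof.
move=> y0.
have hy : hn y != 0 by apply: contra_neq y0 => /hn_eq0.
have hy_gt0 : 0 < hn y by rewrite lt_def hy hn_ge0.
pose z := (hn y)^-1%:C%C *: y.
have zE : y = (hn y)%:C%C *: z by rewrite scalerA -rmorphM/= divff// scale1r.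
exists (inner (T z) z).
  by exists z => //=; rewrite hnE hnZr ?invr_ge0 ?hn_ge0// mulVf.
rewrite {1 2}zE bopZ linearZl_LR linearZr_LR/= conj_real mulrA -rmorphM/=.
by rewrite -expr2.
Qed.

(* After an affine change the two values are 0 and 1; multiplying y by a suitable
   phase w makes the form real on the segment from w y to x, where the
   intermediate value theorem for a quadratic polynomial applies. *)
Lemma numrange_convex T : segment_convex (numrange T).
Proof.
move=> _ _ t [x /= x1 <-] [y /= y1 <-] /andP[t0 t1].
set p := inner (T x) x; set q := inner (T y) y.
have [pq|pq] := eqVneq p q.
  rewrite pq -mulrDl -rmorphD/= addrC subrK mul1r.
  by exists y.
have pq0 : p - q != 0 by rewrite subr_eq0.
have xx : inner x x = 1 by rewrite -normr_inner x1 expr1n.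
have yy : inner y y = 1 by rewrite -normr_inner y1 expr1n.
(* b and c are the cross terms of T - q; divided by p - q, this operator has value 1 at x and 0 at
   y. *)
pose b := inner (T x) y - q * inner x y.
pose c := inner (T y) x - q * inner y x.
have [w [w0 [k kE]]] := real_phase (b / (p - q)) (c / (p - q)).
have {}kE : w^* * b + w * c = k%:C%C * (p - q).
  by rewrite -kE mulrDl -!mulrA mulVf// !mulr1.
have [nw nwE] : exists n : R, w * w^* = n%:C%C.
  by exists ((Re `|w|) ^+ 2); rewrite -normCK rmorphXn; congr (_ ^+ 2);
    rewrite RRe_real ?normr_real.
have [l lE] : exists l : R, w^* * inner x y + w * inner y x = l%:C%C.
  exists (2 * Re (w^* * inner x y)).
  rewrite [inner y x]innerC; case: (inner x y) => u1 u2; case: (w) => w1 w2.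
  by apply/eqP; rewrite eq_complex/=; apply/andP; split; apply/eqP; ring.
have nw_gt0 : 0 < nw by rewrite -ltcR -nwE -normCK exprn_gt0// normr_gt0.
pose z (s : R) := s%:C%C *: x + ((1 - s)%:C%C * w) *: y.
pose n (s : R) := s ^+ 2 + (1 - s) ^+ 2 * nw + s * (1 - s) * l.
have wE s : ((1 - s)%:C%C * w)^* = (1 - s)%:C%C * w^*.
  by rewrite rmorphM/= conj_real.
have nE s : (n s)%:C%C = s%:C%C ^+ 2 + (1 - s)%:C%C ^+ 2 * (w * w^*) +
    s%:C%C * (1 - s)%:C%C * (w^* * inner x y + w * inner y x).
  by rewrite lE nwE -!rmorphXn -!rmorphM -!rmorphD.
have zz s : inner (z s) (z s) = (n s)%:C%C.
  have := inner_comb (bid H) s ((1 - s)%:C%C * w) x y.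
  rewrite -/(z s) => /= ->; rewrite xx yy wE nE.
  by rewrite !rmorphXn/=; ring.
have Tzz s : inner (T (z s)) (z s) =
    q * (n s)%:C%C + (s ^+ 2 + s * (1 - s) * k)%:C%C * (p - q).
  rewrite inner_comb -/p -/q wE -zz.
  have := inner_comb (bid H) s ((1 - s)%:C%C * w) x y.
  rewrite -/(z s) => /= ->; rewrite xx yy wE.
  have -> : (s ^+ 2 + s * (1 - s) * k)%:C%C =
      s%:C%C ^+ 2 + s%:C%C * (1 - s)%:C%C * k%:C%C :> R[i].
    by rewrite -rmorphXn -!rmorphM -rmorphD.
  rewrite [X in _ = _ + X]mulrDl -[X in _ = _ + (_ + X)]mulrA -kE.
  by rewrite /b /c !rmorphXn/=; ring.
(* The polynomial is s^2 + s (1 - s) k - t n(s), with values - t nw at 0 and 1 - t at 1. *)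
have [||s [/andP[s0 s1] sE]] := @quadratic_ivt
    (1 - k - t * (1 + nw - l)) (k - t * (- 2 * nw + l)) (- t * nw).
- by nra.
- by lra.
have root_eq : s ^+ 2 + s * (1 - s) * k = t * n s by rewrite /n; lra.
(* Otherwise s x = - r y; comparing the forms of the identity and of T gives s^2 p = s^2 q, so s =
   0, and then |w|^2 = 0. *)
have zs0 : z s != 0.
  apply/eqP => /eqP; rewrite addr_eq0 => /eqP sxE.
  set r := (1 - s)%:C%C * w in sxE.
  have form0 (A : 'B(H, H)) : (s ^+ 2)%:C%C * inner (A x) x = r * r^* * inner (A y) y.
    have := congr1 (fun v => inner (A v) v) sxE.
    rewrite bopN linearNl linearNr/= opprK !bopZ !linearZl_LR !linearZr_LR/=.
    by rewrite conj_real !mulrA -rmorphM/= -expr2.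
  have := form0 (bid H); rewrite /= xx yy !mulr1 => rr.
  have /eqP := form0 T; rewrite -rr -/p -/q -subr_eq0 -mulrBr mulf_eq0 (negbTE pq0) orbF.
  move=> /eqP s2; have /eqP := s2; rewrite rmorphXn expf_eq0/= => /eqP/complexI s00.
  move: rr; rewrite s2 /r s00 subr0 mul1r nwE => /complexI nw00.
  by move: nw_gt0; rewrite -nw00 ltxx.
have [v vW vE] := numrangeZ T zs0.
suff -> : t%:C%C * p + (1 - t)%:C%C * q = v by [].
have ns : n s = hn (z s) ^+ 2 by apply: complexI; rewrite -zz hn_sqr.
have ns0 : (n s)%:C%C != 0 :> R[i] by rewrite -zz dnorm_eq0.
apply: (mulfI ns0); rewrite ns -vE Tzz root_eq ns rmorphM rmorphB/=.
by ring.
Qed.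

End ToeplitzHausdorff.

(** * Two points of the numerical range of [T_tilde D], and the conclusion *)

Lemma T_tilde_numrange0 (R : realType) (K : hilbertType R) (D : 'B(K, K)) :
  (exists c : K, c != 0) -> numrange (T_tilde D) 0.
Proof.
move=> [c c0].
have cn : `|c| != 0 by rewrite normr_eq0.
pose e : K := `|c|^-1 *: c.
have e1 : `|e| = 1 by rewrite normrZ normfV normr_id mulVf.
(* The second row of [T_tilde D] is zero, so its image of x is orthogonal to x. *)
pose x : hsum K K := (0, e).
exists x.
  have /eqP : `|x| ^+ 2 = 1.
    rewrite normr_inner -[LHS]/(inner (0 : K) 0 + inner e e).
    by rewrite linear0l add0r -normr_inner e1 expr1n.
  by rewrite sqrp_eq1// => /eqP.
rewrite -[LHS]/(inner (D 0 + 0 - ell D e) (0 : K) + inner (0 + 0 : K) e).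
by rewrite linear0r addr0 linear0l addr0.
Qed.

Lemma T_tilde_numrange2 (R : realType) (K : hilbertType R) (D : 'B(K, K)) :
  positiveB (D - bid K) -> (exists c : K, c != 0) -> numrange (T_tilde D) 2%:R.
Proof.
move=> D1 c0; have W0 := T_tilde_numrange0 D c0.
move: c0 => [c c0].
have cn : `|c| != 0 by rewrite normr_eq0.
pose e : K := `|c|^-1 *: c.
have e1 : `|e| = 1 by rewrite normrZ normfV normr_id mulVf.
have ee : inner e e = 1 by rewrite -normr_inner e1 expr1n.
have : 0 <= inner (D e - e) e by exact: D1.
rewrite linearBl/= ee subr_ge0 => De.
have [k kE] : exists k : R, inner (D e) e = k%:C%C.
  by apply/complex_realP/ger0_real/(le_trans ler01).
have k1 : 1 <= k by rewrite -lecR -kE.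
have Wk : numrange (T_tilde D) (k + 1)%:C%C.
  pose x : hsum K K := (e, 0).
  exists x.
    have /eqP : `|x| ^+ 2 = 1.
      rewrite normr_inner -[LHS]/(inner e e + inner (0 : K) 0).
      by rewrite linear0l addr0 ee.
    by rewrite sqrp_eq1// => /eqP.
  rewrite -[LHS]/(inner (D e + e - ell D 0) e + inner (0 + 0 : K) 0).
  by rewrite bop0 subr0 linear0r addr0 linearDl/= kE ee -rmorphD.
have := numrange_convex (t := 2 / (k + 1)) Wk W0.
rewrite mulr0 addr0 -rmorphM/= divfK; last by rewrite gt_eqF//; lra.
rewrite rmorph_nat; apply.
by apply/andP; split; [rewrite divr_ge0//; lra | rewrite ler_pdivrMr; lra].
Qed.

Unset Implicit Arguments.

Theorem theorem4p11 (R : realType) (H : hilbertType R)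
  (Hneq0 : exists x : H, x != 0)
  (Q : 'B(H, H)) (Qidem : idempotentB Q) (Qnproj : ~ projectionB Q)
  (U : 'B(Hcan5 Q, Hcan6 Q)) (D : 'B(Hcan5 Q, Hcan5 Q))
  (QUD : canonical_decomposition U D) :
  interior (closure (numrange (T_op Q))) `<=` numrange (T_tilde D) /\
  numrange (T_tilde D) = numrange (T_op Q).
Proof.
have c0 := Hcan5_neq0 Qidem QUD Qnproj.
have [_ D1 _ _] := QUD.
have W0 := T_tilde_numrange0 D c0.
have W2 := T_tilde_numrange2 D1 c0.
have eqW : numrange (T_tilde D) = numrange (T_op Q).
  rewrite (numrange_T_op Qidem QUD); apply/seteqP; split.
    move=> _ [y y1 <-]; exists 0, 0, y; rewrite !hn0 linear0l mul0rn add0r.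
    by rewrite /hn y1 expr1n expr0n !add0r.
  move=> _ [a [b [y [n1 ->]]]].
  have [w Ww ->] : exists2 w, numrange (T_tilde D) w &
      inner (T_tilde D y) y = (hn y ^+ 2)%:C%C * w.
    have [->|y0] := eqVneq y 0; last exact: numrangeZ.
    by exists 0; rewrite // linear0r mulr0.
  (* The value is a convex combination of 2, w and 0 with weights |a|^2, |y|^2 and |b|^2. *)
  rewrite hn_sqr -mulr_natr.
  apply: segment_convex0_comb => //; [exact: numrange_convex|exact: sqr_ge0..|].
  by rewrite -n1 addrAC lerDl sqr_ge0.
split=> //; rewrite -eqW.
by apply: interior_closure_convex; exact: numrange_convex.
Qed.
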